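(* Let $N\ge0$, $\mathbf a_N=(a(0),\dots,a(N))\in\mathbb C^{N+1}$, $P_1,P_2>0$, and $D=D_f^0\times D_g^0$ with $$D_f^0=\left\{f:\frac1{2\pi}\int_{-\pi}^\pi f(\lambda)d\lambda\le P_1\right\},\qquad D_g^0=\left\{g:\frac1{2\pi}\int_{-\pi}^\pi g(\lambda)d\lambda\le P_2\right\}.$$ Let $f_0\in D_f^0$, $g_0\in D_g^0$ satisfy $\int_{-\pi}^\pi(f_0+g_0)^{-1}d\lambda<\infty$, put $C_N^0(e^{i\lambda})=\sum_{j=0}^N((\mathbf B_N^0)^{-1}\mathbf R_N^0\mathbf a_N)_je^{ij\lambda}$, and let the functions $$h_f(f_0,g_0)=\frac{|A_N(e^{i\lambda})g_0(\lambda)+C_N^0(e^{i\lambda})|^2}{(f_0(\lambda)+g_0(\lambda))^2},\qquad h_g(f_0,g_0)=\frac{|A_N(e^{i\lambda})f_0(\lambda)-C_N^0(e^{i\lambda})|^2}{(f_0(\lambda)+g_0(\lambda))^2}$$ be bounded. Suppose that for some constants $\alpha_1,\alpha_2\ge0$ $$|A_N(e^{i\lambda})g_0(\lambda)+C_N^0(e^{i\lambda})|=\alpha_1(f_0(\lambda)+g_0(\lambda)),\qquad|A_N(e^{i\lambda})f_0(\lambda)-C_N^0(e^{i\lambda})|=\alpha_2(f_0(\lambda)+g_0(\lambda)),$$ and that $(f_0,g_0)$ determines a solution to the optimization problem $$\max_{(f,g)\in D}\left(\langle\mathbf R_N\mathbf a_N,\mathbf B_N^{-1}\mathbf R_N\mathbf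 a_N\rangle+\langle\mathbf Q_N\mathbf a_N,\mathbf a_N\rangle\right)=\langle\mathbf R_N^0\mathbf a_N,(\mathbf B_N^0)^{-1}\mathbf R_N^0\mathbf a_N\rangle+\langle\mathbf Q_N^0\mathbf a_N,\mathbf a_N\rangle .$$ Then $f_0,g_0$ are least favourable in $D$ for the optimal linear estimation of $A_N\xi=\sum_{j=0}^Na(j)\xi(j)$ from observations of $\xi(j)+\eta(j)$, $j\in\mathbb Z\setminus\{0,\dots,N\}$, and $$h^0(e^{i\lambda})=\frac{A_N(e^{i\lambda})f_0(\lambda)-C_N^0(e^{i\lambda})}{f_0(\lambda)+g_0(\lambda)}$$ is the minimax-robust spectral characteristic of the optimal linear estimate of $A_N\xi$.
   Context: $\xi,\eta$ are zero mean uncorrelated wide sense stationary sequences with spectral densities $f,g$ ($E\xi(j+k)\overline{\xi(j)}=\frac1{2\pi}\int e^{ik\lambda}f\,d\lambda$, etc.). $A_N(e^{i\lambda})=\sum_{j=0}^Na(j)e^{ij\lambda}$, $\langle x,y\rangle=\sum_{k=0}^Nx_k\overline{y_k}$. $\mathbf B_N,\mathbf R_N,\mathbf Q_N$ are the $(N+1)\times(N+1)$ matrices with entries $\frac1{2\pi}\int_{-\pi}^\pi e^{-i(j-k)\lambda}\psi(\lambda)d\lambda$, $j,k=0,\dots,N$, with $\psi=\frac1{f+g}$, $\frac f{f+g}$, $\frac{fg}{f+g}$ respectively; superscript $0$ refers to $(f_0,g_0)$. Wherever $\mathbf B_N^{-1}$ is used, $(f,g)$ is understood to satisfy the minimality condition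 $\int(f+g)^{-1}d\lambda<\infty$. $L_2^N(f+g)$ is the closed span of $\{e^{ij\lambda}:j\in\mathbb Z\setminus\{0,\dots,N\}\}$ in $L_2(f+g)$; for $h\in L_2^N(f+g)$, $\Delta(h;f,g)=\frac1{2\pi}\int|A_N-h|^2f\,d\lambda+\frac1{2\pi}\int|h|^2g\,d\lambda$, and $h(f,g)$ is its minimizer. $(f_0,g_0)\in D$ is least favourable if $\Delta(h(f_0,g_0);f_0,g_0)=\max_{(f,g)\in D}\Delta(h(f,g);f,g)$. $h^0$ is minimax-robust if $h^0\in H_D=\bigcap_{(f,g)\in D}L_2^N(f+g)$ and $\min_{h\in H_D}\max_{(f,g)\in D}\Delta(h;f,g)=\sup_{(f,g)\in D}\Delta(h^0;f,g)$. *)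

(* Defs.v *)
From mathcomp Require Import all_boot all_order all_algebra.
From mathcomp Require Import all_classical all_reals all_analysis.
From mathcomp Require Import complex.

Set Implicit Arguments.
Unset Strict Implicit.
Unset Printing Implicit Defensive.

Import Order.TTheory GRing.Theory Num.Theory numFieldNormedType.Exports.
Import ComplexField.Normc.

Local Open Scope classical_set_scope.
Local Open Scope complex_scope.
Local Open Scope ring_scope.

Section Interpolation.
Variable R : realType.

Local Notation mu := (@lebesgue_measure R).

Definition circ : set R := `[- pi, pi].

(** e^{i t} *)
Definition expi (t : R) : R[i] := cos t +i* sin t.

(** Componentwise; meaningful when both components are integrable. *)
Definition cintegral (u : R -> R[i]) : R[i] :=
  Rintegral mu circ (fun x => complex.Re (u x))
    +i* Rintegral mu circ (fun x => complex.Im (u x)).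

Definition cmeasurable (h : R -> R[i]) : Prop :=
  measurable_fun circ (fun x => complex.Re (h x)) /\
  measurable_fun circ (fun x => complex.Im (h x)).

(** Density with respect to d lambda; the covariance of lag k is
    (2 pi)^-1 times the integral of e^{i k lambda} f(lambda). *)
Definition spectral_density (f : R -> R) : Prop :=
  [/\ measurable_fun circ f, (forall x, circ x -> 0 <= f x) &
      mu.-integrable circ (EFin \o f)].

Definition mean (f : R -> \bar R) : \bar R :=
  (((2 * pi)^-1)%:E * \int[mu]_(x in circ) f x)%E.

(** The set of densities f with (2 pi)^-1 \int f <= P. *)
Definition power_class (P : R) : set (R -> R) :=
  [set f | spectral_density f /\ (mean (EFin \o f) <= P%:E)%E].

(** The inverse is the one of \bar R, for which 0^-1 = +oo; the condition thus
    forces f + g > 0 almost everywhere. *)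
Definition minimal (f g : R -> R) : Prop :=
  (\int[mu]_(x in circ) ((f x + g x)%:E)^-1 < +oo)%E.

Definition trig_poly N (a : 'cV[R[i]]_N.+1) (x : R) : R[i] :=
  \sum_(j < N.+1) a j 0 * expi (j%:R * x).

Definition toeplitz N (psi : R -> R) : 'M[R[i]]_N.+1 :=
  \matrix_(j, k) (((2 * pi)^-1)%:C *
    cintegral (fun x => expi (- ((j%:R - k%:R) * x)) * (psi x)%:C)).

Definition Bmx N (f g : R -> R) := toeplitz N (fun x => (f x + g x)^-1).
Definition Rmx N (f g : R -> R) := toeplitz N (fun x => f x / (f x + g x)).
Definition Qmx N (f g : R -> R) :=
  toeplitz N (fun x => f x * g x / (f x + g x)).

Definition inner N (x y : 'cV[R[i]]_N.+1) : R[i] :=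
  \sum_(k < N.+1) x k 0 * (y k 0)^*.

(** The vector B^-1 R a of coefficients of C_N. *)
Definition Ccoef N (a : 'cV[R[i]]_N.+1) (f g : R -> R) : 'cV[R[i]]_N.+1 :=
  invmx (Bmx N f g) *m Rmx N f g *m a.

(** The objective is real because B, R and Q are Hermitian; the order on R[i]
    compares real parts and requires equal imaginary parts. *)
Definition objective N (a : 'cV[R[i]]_N.+1) (f g : R -> R) : R[i] :=
  inner (Rmx N f g *m a) (invmx (Bmx N f g) *m (Rmx N f g *m a)) +
  inner (Qmx N f g *m a) a.

(** Linear span of the e^{i j x} with j an integer outside {0, ..., N}. *)
Definition observed_span N : set (R -> R[i]) :=
  [set p | exists (s : seq int) (c : int -> R[i]),
     (forall j, j \in s -> ~~ (0 <= j <= N%:Z)) /\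
     p = fun x => \sum_(j <- s) c j * expi (j%:~R * x)].

Definition sqdist (w : R -> R) (h p : R -> R[i]) : \bar R :=
  \int[mu]_(x in circ) (normc (h x - p x) ^+ 2 * w x)%:E.

(** The space L_2^N(w); elements are representatives of classes. *)
Definition L2N N (w : R -> R) : set (R -> R[i]) :=
  [set h | [/\ cmeasurable h,
     (sqdist w h (fun=> 0%R) < +oo)%E &
     forall e : R, 0 < e ->
       exists2 p, observed_span N p & (sqdist w h p < e%:E)%E]].

Definition Delta N (a : 'cV[R[i]]_N.+1) (h : R -> R[i]) (f g : R -> R) :
    \bar R :=
  (mean (fun x => (normc (trig_poly a x - h x) ^+ 2 * f x)%:E) +
   mean (fun x => (normc (h x) ^+ 2 * g x)%:E))%E.

(** h is (a representative of) the minimizer h(f, g); minimizers are unique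
    up to (f + g) d lambda null sets. *)
Definition optimal_char N (a : 'cV[R[i]]_N.+1) (f g : R -> R)
    (h : R -> R[i]) : Prop :=
  L2N N (f \+ g) h /\
  forall h', L2N N (f \+ g) h' -> (Delta a h f g <= Delta a h' f g)%E.

Definition least_favourable N (a : 'cV[R[i]]_N.+1)
    (D : set ((R -> R) * (R -> R))) (f0 g0 : R -> R) : Prop :=
  D (f0, g0) /\
  exists2 h0, optimal_char a f0 g0 h0 &
    forall f g h, D (f, g) -> optimal_char a f g h ->
      (Delta a h f g <= Delta a h0 f0 g0)%E.

Definition Hclass N (D : set ((R -> R) * (R -> R))) : set (R -> R[i]) :=
  \bigcap_(fg in D) L2N N (fg.1 \+ fg.2).

Definition worst_error N (a : 'cV[R[i]]_N.+1)
    (D : set ((R -> R) * (R -> R))) (h : R -> R[i]) : \bar R :=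
  ereal_sup [set Delta a h fg.1 fg.2 | fg in D].

(** As h0 lies in Hclass N D, the infimum below is attained. *)
Definition minimax_robust N (a : 'cV[R[i]]_N.+1)
    (D : set ((R -> R) * (R -> R))) (h0 : R -> R[i]) : Prop :=
  Hclass N D h0 /\
  ereal_inf [set worst_error a D h | h in Hclass N D] = worst_error a D h0.

(** A_N g + C_N  and  A_N f - C_N *)
Definition num_f N (a : 'cV[R[i]]_N.+1) (f g : R -> R) (x : R) : R[i] :=
  trig_poly a x * (g x)%:C + trig_poly (Ccoef a f g) x.
Definition num_g N (a : 'cV[R[i]]_N.+1) (f g : R -> R) (x : R) : R[i] :=
  trig_poly a x * (f x)%:C - trig_poly (Ccoef a f g) x.

Definition h_f N (a : 'cV[R[i]]_N.+1) (f g : R -> R) (x : R) : R :=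
  normc (num_f a f g x) ^+ 2 / (f x + g x) ^+ 2.
Definition h_g N (a : 'cV[R[i]]_N.+1) (f g : R -> R) (x : R) : R :=
  normc (num_g a f g x) ^+ 2 / (f x + g x) ^+ 2.

(** Densities are defined up to null sets, hence relations between functions
    of lambda are meant almost everywhere on [-pi, pi]. *)
Definition ae_on_circ (P : R -> Prop) : Prop :=
  {ae mu, forall x, circ x -> P x}.

Definition ess_bounded (u : R -> R) : Prop :=
  exists M : R, ae_on_circ (fun x => `|u x| <= M).

End Interpolation.

(* Main.v *)
Require Import Defs.
From mathcomp Require Import all_boot all_order all_algebra.
From mathcomp Require Import all_classical all_reals all_analysis.
From mathcomp Require Import measurable_realfun complex.
From mathcomp Require Import ring lra.

Import Order.TTheory GRing.Theory Num.Theory numFieldNormedType.Exports.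
Import ComplexField.Normc.

Local Open Scope classical_set_scope.
Local Open Scope complex_scope.
Local Open Scope ring_scope.

Set Implicit Arguments.
Unset Strict Implicit.
Unset Printing Implicit Defensive.

(* The candidate h0 = (A f0 - C0) / (f0 + g0) satisfies |A - h0| = alpha1 and
   |h0| = alpha2 almost everywhere, so its error at (f, g) is
   alpha1^2 mean f + alpha2^2 mean g <= alpha1^2 P1 + alpha2^2 P2 on D.

   This bound is attained at (f0, g0).  Otherwise raise f0 and g0 by their
   slacks c1 = P1 - mean f0 and c2 = P2 - mean g0, and let h1 be the
   characteristic of the new pair.  The objective is the minimal error, so by
   maximality the error of h1 at (f0, g0), plus the means of c1 |A - h1|^2 and
   c2 |h1|^2, is at most the error of h0.  By the Pythagoras identity at
   (f0, g0) this forces h1 = h0 and then c1 alpha1 = c2 alpha2 = 0.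

   It remains to see that h0 lies in L_2^N(w) for every integrable w, minimal
   or not.  Since B C = R a, the Fourier coefficients of h0 at 0, ..., N
   vanish.  As h0 is bounded, trigonometric sums approximate it in
   L_2(w + 1); their coefficients at 0, ..., N are then small and can be
   removed at a small uniform cost. *)

(** * Integrals over the circle *)

(** The class [D] contains pairs for which [1 / (f + g)] is not integrable, and the robust
    characteristic must be admissible for them too. For such a weight Fourier coefficients need not
    be continuous on L_2(f + g), so membership in L_2^N cannot be read off from vanishing
    coefficients by duality; it has to come from explicit approximation. This is why the density of
    trigonometric sums is proved for every integrable weight, zeros allowed. The converse, that
    members of L_2^N have vanishing coefficients, is used for minimal pairs only.

    The slack argument is forced by the shape of the hypotheses: the power constraints are
    inequalities, so the means of [f0] and [g0] may a priori stay below [P1] and [P2], and the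
    maximality assumption speaks only about minimal pairs. Raising the densities by constants
    respects both points, because the new sum is bounded away from 0. *)

Section RealIntegrals.
Context {R : realType}.
Local Notation mu := (@lebesgue_measure R).
Local Notation circ := (@circ R).
Implicit Types u v w : R -> R.

Definition itg u := mu.-integrable circ (EFin \o u).
Definition circint u : R := Rintegral mu circ u.

Lemma measurable_circ : measurable circ.
Proof. exact: measurable_itv. Qed.
Hint Resolve measurable_circ : core.

Let ae_lebesgue_filter : Filter (nbhs (almost_everywhere mu)).
Proof. exact: ae_filter_ringOfSetsType. Qed.
Existing Instance ae_lebesgue_filter.

Lemma circE x : circ x = (- pi <= x <= pi) :> Prop.
Proof. by rewrite /Defs.circ /= in_itv. Qed.

Lemma circ_measure : mu circ = (2 * pi)%:E.
Proof.
rewrite lebesgue_measure_itv/= lte_fin ifT; last by have := pi_gt0 R; lra.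
by rewrite -EFinD; congr EFin; ring.
Qed.

Lemma itg_measurable u : itg u -> measurable_fun circ u.
Proof. by move=> /measurable_int/measurable_EFinP. Qed.

Lemma measurable_inv_ge0 u : measurable_fun circ u ->
  (forall x, circ x -> 0 <= u x) -> measurable_fun circ (fun x => (u x)^-1).
Proof.
move=> mu_ u0; apply: (@eq_measurable_fun _ _ _ _ _ (fun x => u x `^ (-1))).
  by move=> x /set_mem cx; rewrite powR_inv1// u0.
by apply: (@measurableT_comp _ _ _ _ _ _ (@powR R ^~ (-1))).
Qed.

Lemma measurable_EFin u : measurable_fun circ u ->
  measurable_fun circ (fun x => (u x)%:E).
Proof. by move=> mu_; apply/measurable_EFinP. Qed.

Lemma itgD u w : itg u -> itg w -> itg (fun x => u x + w x).
Proof. exact: integrableD. Qed.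

Lemma itgZ c u : itg u -> itg (fun x => c * u x).
Proof. exact: integrableZl. Qed.

Lemma itgN u : itg u -> itg (fun x => - u x).
Proof. exact: integrableN. Qed.

Lemma itgB u w : itg u -> itg w -> itg (fun x => u x - w x).
Proof. by move=> iu iw; apply: itgD => //; exact: itgN. Qed.

Lemma itg_cst c : itg (fun=> c).
Proof.
apply/integrableP; split; first exact/measurable_EFinP/measurable_cst.
by rewrite [X in (X < _)%E]integral_cst//= circ_measure -EFinM ltry.
Qed.

Lemma itg_le_ae u v : measurable_fun circ u -> itg v ->
  ae_on_circ (fun x => `|u x| <= v x) -> itg u.
Proof.
move=> mu_ iv uv; have mv := itg_measurable iv.
have /integrableP[_ fv] := integrable_norm iv.
apply/integrableP; split; first exact/measurable_EFinP.
apply: le_lt_trans fv; apply: ae_ge0_le_integral => //.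
- by apply/measurable_EFinP; exact: measurableT_comp.
- apply/measurable_EFinP; do 2 (apply: measurableT_comp => //).
rewrite /ae_on_circ in uv; apply: filterS uv => x xuv /xuv {}xuv.
by rewrite /= lee_fin normr_id (le_trans xuv)// ler_norm.
Qed.

Lemma itg_le u v : measurable_fun circ u -> itg v ->
  (forall x, circ x -> `|u x| <= v x) -> itg u.
Proof. by move=> mu_ iv uv; apply: itg_le_ae iv _ => //; exact: aeW. Qed.

Lemma itg_bndM u v K : measurable_fun circ u ->
  (forall x, circ x -> `|u x| <= K) -> itg v -> itg (fun x => u x * v x).
Proof.
move=> mu_ uK iv; have mv := itg_measurable iv.
apply: (@itg_le _ (fun x => K * `|v x|)); first exact: measurable_funM.
  by apply: itgZ; exact: integrable_norm.
by move=> x cx; rewrite normrM ler_wpM2r// uK.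
Qed.

Lemma circintD u w : itg u -> itg w ->
  circint (fun x => u x + w x) = circint u + circint w.
Proof. exact: RintegralD. Qed.

Lemma circintB u w : itg u -> itg w ->
  circint (fun x => u x - w x) = circint u - circint w.
Proof. exact: RintegralB. Qed.

Lemma circintZ c u : itg u -> circint (fun x => c * u x) = c * circint u.
Proof. exact: RintegralZl. Qed.

Lemma circint_cst c : circint (fun=> c) = c * (2 * pi).
Proof. by rewrite /circint Rintegral_cst//= circ_measure. Qed.

Lemma circint_ge0 u : (forall x, circ x -> 0 <= u x) -> 0 <= circint u.
Proof. by move=> u0; rewrite /circint; apply: Rintegral_ge0 => x; exact: u0. Qed.

Lemma circint_le u w : itg u -> itg w -> (forall x, circ x -> u x <= w x) ->
  circint u <= circint w.
Proof. exact: le_Rintegral. Qed.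

Lemma circint_eq u w : (forall x, circ x -> u x = w x) -> circint u = circint w.
Proof. by move=> uw; apply: eq_Rintegral => x /set_mem; exact: uw. Qed.

Lemma circint_norm u : itg u -> `|circint u| <= circint (fun x => `|u x|).
Proof. exact: le_normr_Rintegral. Qed.

Lemma circint_ae u w : measurable_fun circ u -> measurable_fun circ w ->
  ae_on_circ (fun x => u x = w x) -> circint u = circint w.
Proof.
move=> mu_ mw uw; rewrite /circint /Rintegral; congr fine.
apply: ae_eq_integral => //; try exact/measurable_EFinP.
by rewrite /ae_on_circ in uw; apply: filterS uw => x xuw /xuw ->.
Qed.

Lemma EFin_circint u : itg u -> (circint u)%:E = (\int[mu]_(x in circ) (u x)%:E)%E.
Proof. by move=> iu; rewrite fineK//; exact: integrable_fin_num. Qed.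

Lemma ae_true (P : R -> Prop) : (forall x, circ x -> P x) -> ae_on_circ P.
Proof. by move=> Px; rewrite /ae_on_circ; apply: aeW => x; exact: Px. Qed.

Lemma ae_and (P Q : R -> Prop) :
  ae_on_circ P -> ae_on_circ Q -> ae_on_circ (fun x => P x /\ Q x).
Proof.
by rewrite /ae_on_circ; apply: filterS2 => x p q cx; split; [exact: p|exact: q].
Qed.

Lemma ae_imp (P Q : R -> Prop) : (forall x, circ x -> P x -> Q x) ->
  ae_on_circ P -> ae_on_circ Q.
Proof. by move=> PQ; rewrite /ae_on_circ; apply: filterS => x p cx; exact/PQ/p. Qed.

Lemma ae_notin1 (a : R) : ae_on_circ (fun x => x <> a).
Proof.
exists [set a]; split => //; first exact: lebesgue_measure_set1.
by move=> x /= h; apply: contra_notP h => xa _.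
Qed.

Lemma ae_ex (P : R -> Prop) : ae_on_circ P -> exists2 x, circ x & P x.
Proof.
move=> [N [mN N0 PN]]; apply: contrapT => nP.
have : circ `<=` N.
  by move=> x cx; apply: PN => /= /(_ cx) px; apply: nP; exists x.
move=> /(le_measure mu); rewrite !inE => /(_ measurable_circ mN).
rewrite [X in (_ <= X)%E -> _]N0 [X in (X <= _)%E -> _]circ_measure lee_fin.
by have := pi_gt0 R; lra.
Qed.

Lemma circint_ge0_eq0 u : itg u -> (forall x, circ x -> 0 <= u x) ->
  circint u <= 0 -> ae_on_circ (fun x => u x = 0).
Proof.
move=> iu u0 Iu; have /measurable_EFinP mu_ := itg_measurable iu.
have Iu0 : circint u = 0 by apply/eqP; rewrite eq_le Iu circint_ge0.
have : (\int[mu]_(x in circ) `|(u x)%:E| = 0)%E.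
  transitivity (circint u)%:E; last by rewrite Iu0.
  rewrite EFin_circint//; apply: eq_integral => x /set_mem cx.
  by rewrite gee0_abs// lee_fin u0.
have [h _] := ae_eq_integral_abs mu measurable_circ mu_.
by move=> /h; apply: filterS => x {}h /h[].
Qed.

Lemma circint_dominated (u_ : nat -> R -> R) u v :
  (forall n, measurable_fun circ (u_ n)) -> measurable_fun circ u -> itg v ->
  ae_on_circ (fun x => u_ ^~ x @ \oo --> u x) ->
  (forall n x, circ x -> `|u_ n x| <= v x) ->
  circint (u_ n) @[n --> \oo] --> circint u.
Proof.
move=> mu_ mu1 iv cv uv.
have [] := @dominated_convergence _ _ _ mu circ measurable_circ
  (fun n => EFin \o u_ n) (EFin \o u) (EFin \o v).
- by move=> n; apply/measurable_EFinP; exact: mu_.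
- exact/measurable_EFinP.
- rewrite /ae_on_circ in cv; apply: filterS cv => x h /h {}h.
  by apply: cvg_EFin => //; exact: nearW.
- exact: iv.
- by apply: aeW => x n cx; rewrite /= lee_fin; exact: uv.
move=> iu _ h.
have iun n : itg (u_ n) by exact: itg_le (mu_ n) iv (uv n).
rewrite -EFin_circint// in h; move/fine_cvg : h; apply: cvg_trans.
by apply: near_eq_cvg; near=> n.
Unshelve. all: by end_near. Qed.

End RealIntegrals.
#[export] Hint Extern 0 (measurable _) => solve [exact: measurable_circ] : core.

(** * Density of trigonometric polynomials in weighted L_2 *)

Section Density.
Context {R : realType}.
Local Notation mu := (@lebesgue_measure R).
Local Notation circ := (@circ R).
Implicit Types u v w : R -> R.

(** The algebra generated by cosine and sine. Closure under products gives powers and partial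
    geometric sums at once; the passage to complex exponentials is made only at the end, in
    [real_trig_sum_exp]. *)
Inductive real_trig : (R -> R) -> Prop :=
| real_trig_cst c : real_trig (fun=> c)
| real_trig_cos : real_trig (@cos R)
| real_trig_sin : real_trig (@sin R)
| real_trigD p q : real_trig p -> real_trig q -> real_trig (fun x => p x + q x)
| real_trigM p q : real_trig p -> real_trig q -> real_trig (fun x => p x * q x).

Lemma real_trigX p n : real_trig p -> real_trig (fun x => p x ^+ n).
Proof.
move=> tp; elim: n => [|n ih]; first exact: real_trig_cst.
by under [fun x => _]funext do rewrite exprS; exact: real_trigM.
Qed.

Lemma real_trigB p q : real_trig p -> real_trig q -> real_trig (fun x => p x - q x).
Proof.
move=> tp tq; under [fun x => _]funext do rewrite -mulN1r.
by apply: real_trigD => //; apply: real_trigM => //; exact: real_trig_cst.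
Qed.

Lemma real_trig_sum n (p : nat -> R -> R) : (forall k, real_trig (p k)) ->
  real_trig (fun x => \sum_(k < n) p k x).
Proof.
move=> tp; elim: n => [|n ih].
  by under [fun x => _]funext do rewrite big_ord0; exact: real_trig_cst.
by under [fun x => _]funext do rewrite big_ord_recr/=; exact: real_trigD.
Qed.

Lemma real_trig_cosB c : real_trig (fun x => cos (x - c)).
Proof.
under [fun x => _]funext do rewrite cosB.
apply: real_trigD; apply: real_trigM;
  solve [exact: real_trig_cst | exact: real_trig_cos | exact: real_trig_sin].
Qed.

Definition bdd_measurable u :=
  measurable_fun circ u /\ exists K, forall x, circ x -> `|u x| <= K.

Lemma bdd_measurable_cst c : bdd_measurable (fun=> c).
Proof. by split; [exact: measurable_cst|exists `|c|]. Qed.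

Lemma bdd_measurableD u w : bdd_measurable u -> bdd_measurable w ->
  bdd_measurable (fun x => u x + w x).
Proof.
move=> [mu1 [K uK]] [mw [L wL]]; split; first exact: measurable_funD.
exists (K + L) => x cx.
by rewrite (le_trans (ler_normD _ _))// lerD ?uK ?wL.
Qed.

Lemma bdd_measurableM u w : bdd_measurable u -> bdd_measurable w ->
  bdd_measurable (fun x => u x * w x).
Proof.
move=> [mu1 [K uK]] [mw [L wL]]; split; first exact: measurable_funM.
by exists (K * L) => x cx; rewrite normrM ler_pM ?uK ?wL.
Qed.

Lemma bdd_measurableB u w : bdd_measurable u -> bdd_measurable w ->
  bdd_measurable (fun x => u x - w x).
Proof.
move=> bu bw; under [fun x => _]funext do rewrite -mulN1r.
by apply: bdd_measurableD => //; apply: bdd_measurableM => //;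
  exact: bdd_measurable_cst.
Qed.

Lemma bdd_measurable_trig p : real_trig p -> bdd_measurable p.
Proof.
elim=> [c||| |].
- exact: bdd_measurable_cst.
- split; last by exists 1 => x _; exact: cos_max.
  by apply: measurable_funTS; apply: continuous_measurable_fun; exact: continuous_cos.
- split; last by exists 1 => x _; exact: sin_max.
  by apply: measurable_funTS; apply: continuous_measurable_fun; exact: continuous_sin.
- by move=> p1 q _ bp _ bq; exact: bdd_measurableD.
- by move=> p1 q _ bp _ bq; exact: bdd_measurableM.
Qed.

Variable v : R -> R.
Hypothesis v_itg : itg v.
Hypothesis v_ge0 : forall x, circ x -> 0 <= v x.

Definition dist2 u w := circint (fun x => (u x - w x) ^+ 2 * v x).

Lemma dist2_itg u w : bdd_measurable u -> bdd_measurable w ->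
  itg (fun x => (u x - w x) ^+ 2 * v x).
Proof.
move=> bu bw; have [md [K dK]] := bdd_measurableB bu bw.
apply: (@itg_bndM _ (fun x => (u x - w x) ^+ 2) v (K ^+ 2)) => //.
  exact: measurable_funX.
by move=> x cx; rewrite normrX lerXn2r ?nnegrE ?dK// (le_trans _ (dK x cx)).
Qed.

Lemma dist2_triangle u w z :
  bdd_measurable u -> bdd_measurable w -> bdd_measurable z ->
  dist2 u z <= 2 * dist2 u w + 2 * dist2 w z.
Proof.
move=> bu bw bz; rewrite -!circintZ -?circintD; do ?[exact: dist2_itg|apply: itgZ].
apply: circint_le; first exact: dist2_itg.
  by apply: itgD; apply: itgZ; exact: dist2_itg.
move=> x cx; rewrite !mulrA -mulrDl ler_wpM2r ?v_ge0//.
have := sqr_ge0 ((u x - w x) - (w x - z x)); nra.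
Qed.

(** Boundedness is included so that every distance [dist2] is the integral of an integrable
    function. *)
Definition trig_approx u := bdd_measurable u /\
  forall e, 0 < e -> exists2 p, real_trig p & dist2 u p < e.

Lemma trig_approx_trig p : real_trig p -> trig_approx p.
Proof.
move=> tp; split; first exact: bdd_measurable_trig.
move=> e e0; exists p => //; rewrite /dist2.
by under [fun x => _]funext do rewrite subrr expr0n mul0r; rewrite circint_cst mul0r.
Qed.

Lemma trig_approxD u w : trig_approx u -> trig_approx w ->
  trig_approx (fun x => u x + w x).
Proof.
move=> [bu au] [bw aw]; split; first exact: bdd_measurableD.
move=> e e0; have [p tp up] := au (e / 4) ltac:(lra).
have [q tq wq] := aw (e / 4) ltac:(lra).
have bp := bdd_measurable_trig tp; have bq := bdd_measurable_trig tq.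
exists (fun x => p x + q x); first exact: real_trigD.
suff : dist2 (fun x => u x + w x) (fun x => p x + q x) <=
    2 * dist2 u p + 2 * dist2 w q by lra.
rewrite -!circintZ -?circintD; do ?[exact: dist2_itg|apply: itgZ].
apply: circint_le; first by apply: dist2_itg; exact: bdd_measurableD.
  by apply: itgD; apply: itgZ; exact: dist2_itg.
move=> x cx; rewrite !mulrA -mulrDl ler_wpM2r ?v_ge0//.
have := sqr_ge0 ((u x - p x) - (w x - q x)); nra.
Qed.

Lemma trig_approxZ c u : trig_approx u -> trig_approx (fun x => c * u x).
Proof.
move=> [bu au]; have bc := bdd_measurable_cst c.
split; first exact: bdd_measurableM.
(* The [+ 1] keeps the denominator positive when [c = 0]. *)
move=> e e0; have c2 : 0 < c ^+ 2 + 1 by have := sqr_ge0 c; lra.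
have [p tp up] := au (e / (c ^+ 2 + 1)) ltac:(exact: divr_gt0).
have bp := bdd_measurable_trig tp.
exists (fun x => c * p x); first by apply: real_trigM => //; exact: real_trig_cst.
have -> : dist2 (fun x => c * u x) (fun x => c * p x) = c ^+ 2 * dist2 u p.
  rewrite -circintZ; last exact: dist2_itg.
  by apply: circint_eq => x _; ring.
have d0 : 0 <= dist2 u p.
  by apply: circint_ge0 => x cx; rewrite mulr_ge0 ?sqr_ge0 ?v_ge0.
by move: up; rewrite ltr_pdivlMr//; nra.
Qed.

Lemma trig_approxB u w : trig_approx u -> trig_approx w ->
  trig_approx (fun x => u x - w x).
Proof.
move=> au aw; under [fun x => _]funext do rewrite -mulN1r.
by apply: trig_approxD => //; exact: trig_approxZ.
Qed.

Lemma trig_approx_cst c : trig_approx (fun=> c).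
Proof. by apply: trig_approx_trig; exact: real_trig_cst. Qed.

(** Dominated convergence with majorant [(K + K) ^+ 2 * v]. Geometric series, indicators, increasing
    unions and simple functions all enter the approximable class through this closure property. *)
Lemma trig_approx_lim (u_ : nat -> R -> R) u K :
  (forall n, trig_approx (u_ n)) -> measurable_fun circ u ->
  (forall n x, circ x -> `|u_ n x| <= K) ->
  (forall x, circ x -> `|u x| <= K) ->
  ae_on_circ (fun x => u_ ^~ x @ \oo --> u x) ->
  trig_approx u.
Proof.
move=> au mu1 uK uK' cu; have bu : bdd_measurable u by split=> //; exists K.
split=> // e e0.
have : dist2 u (u_ n) @[n --> \oo] --> circint (fun=> 0).
  apply: (@circint_dominated _ (fun n x => (u x - u_ n x) ^+ 2 * v x) _
            (fun x => (K + K) ^+ 2 * v x)).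
  - by move=> n; apply: itg_measurable; apply: dist2_itg => //; exact: (au n).1.
  - exact: measurable_cst.
  - exact: itgZ.
  - apply: ae_imp cu => x cx h; have -> : 0 = (u x - u x) * (u x - u x) * v x by ring.
    under eq_fun do rewrite expr2.
    by apply: cvgM; [apply: cvgM; apply: cvgB => //|]; exact: cvg_cst.
  - move=> n x cx; rewrite normrM normrX (ger0_norm (v_ge0 cx)) ler_wpM2r ?v_ge0//.
    have := uK n x cx; have := uK' x cx; move=> h1 h2.
    have h3 : `|u x - u_ n x| <= K + K.
      by rewrite (le_trans (ler_normB _ _))// lerD.
    by rewrite lerXn2r ?nnegrE// (le_trans _ h3).
(* [e / 4] is taken twice because [dist2_triangle] doubles both terms. *)
rewrite circint_cst mul0r => /cvgr0Pnorm_lt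
  /(_ (e / 4) ltac:(lra)) [n _ /(_ n (leqnn n))].
move=> /ltr_normlW un.
have [bn /(_ (e / 4) ltac:(lra)) [p tp np]] := au n.
exists p => //; have := dist2_triangle bu bn (bdd_measurable_trig tp); lra.
Qed.

End Density.

(** * From trigonometric polynomials to indicators and bounded measurable functions *)

Section DensityIndic.
Context {R : realType}.
Local Notation mu := (@lebesgue_measure R).
Local Notation circ := (@circ R).
Variable v : R -> R.
Hypothesis v_itg : itg v.
Hypothesis v_ge0 : forall x, circ x -> 0 <= v x.
Local Notation trig_approx := (trig_approx v).

(* [1 / (1 + s)] is the sum of a geometric series in [(M - s) / (1 + M)],
   which lies in [0, 1[. *)
Lemma trig_approx_inv1D s M : real_trig s ->
  (forall x, 0 <= s x <= M) -> trig_approx (fun x => (1 + s x)^-1).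
Proof.
move=> ts sM; pose z x := (1 + M)^-1 * (M - s x).
have M1 : 0 < 1 + M by have := sM 0; lra.
have z0 x : 0 <= z x.
  by apply: mulr_ge0; [rewrite invr_ge0 ltW|have := sM x; lra].
have z1 x : z x < 1 by rewrite /z mulrC ltr_pdivrMr//; have := sM x; lra.
have tz : real_trig z.
  by apply: real_trigM; [|apply: real_trigB => //]; exact: real_trig_cst.
pose u n x := \sum_(k < n) (1 + M)^-1 * z x ^+ k.
have tu n : real_trig (u n).
  apply: (@real_trig_sum _ n (fun k x => (1 + M)^-1 * z x ^+ k)) => k.
  apply: real_trigM; first exact: real_trig_cst.
  exact: real_trigX.
have s1 x : 0 < 1 + s x by have := sM x; lra.
(* Since [1 - z x = (1 + s x) / (1 + M)], the sum telescopes. With [0 <= s x] this also yields the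
   uniform bound [u n x <= 1]. *)
have uE n x : (1 + s x) * u n x = 1 - z x ^+ n.
  elim: n => [|n ih]; first by rewrite /u big_ord0; ring.
  rewrite /u big_ord_recr/= mulrDr ih exprS /z.
  by field; rewrite gt_eqF.
have u0 n x : 0 <= u n x.
  by apply: sumr_ge0 => k _; rewrite mulr_ge0 ?exprn_ge0// invr_ge0 ltW.
apply: (@trig_approx_lim _ _ v_itg v_ge0 u _ 1).
- by move=> n; exact: trig_approx_trig.
- have [ms _] := bdd_measurable_trig ts.
  apply: measurable_inv_ge0 => [|x _]; last exact: ltW.
  by apply: measurable_funD => //; exact: measurable_cst.
- move=> n x _; rewrite ger0_norm//; have := uE n x; have := u0 n x.
  by have := sM x; have := exprn_ge0 n (z0 x); nra.
- move=> x _; rewrite ger0_norm; last by rewrite invr_ge0 ltW.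
  by rewrite invf_le1//; have := sM x; lra.
- apply: ae_true => x _.
  have -> : u ^~ x = (fun n => (1 + s x)^-1 * (1 - z x ^+ n)).
    by apply/funext => n; rewrite -uE mulKf// gt_eqF.
  suff : (1 + s x)^-1 * (1 - z x ^+ n) @[n --> \oo] --> (1 + s x)^-1 * (1 - 0).
    by rewrite subr0 mulr1.
  apply: cvgM; first exact: cvg_cst.
  apply: cvgB; first exact: cvg_cst.
  by apply: cvg_expr; rewrite ger0_norm.
Qed.

(* [1 / (1 + q ^ n)] tends boundedly to the indicator of [q < 1]. *)
Lemma trig_approx_indic_lt1 q M (A : set R) : real_trig q ->
  (forall x, 0 <= q x <= M) -> measurable A ->
  ae_on_circ (fun x => (A x /\ q x < 1) \/ (~ A x /\ 1 < q x)) ->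
  trig_approx \1_A.
Proof.
move=> tq qM mA Aq; have q0 x : 0 <= q x by have := qM x; lra.
apply: (@trig_approx_lim _ _ v_itg v_ge0 (fun n x => (1 + q x ^+ n)^-1) _ 1).
- move=> n; apply: (@trig_approx_inv1D (fun x => q x ^+ n) (M ^+ n)).
    exact: real_trigX.
  by move=> x; rewrite exprn_ge0//= lerXn2r ?nnegrE//; have := qM x; lra.
- exact: measurable_indic.
- move=> n x _; have := exprn_ge0 n (q0 x) => h.
  by rewrite ger0_norm ?invr_ge0 ?invf_le1; lra.
- by move=> x _; rewrite indicE; case: (_ \in _); rewrite ?normr1 ?normr0.
apply: ae_imp Aq => x _ [[Ax qx]|[nAx qx]].
  rewrite indicE mem_set//=.
  suff : (1 + q x ^+ n)^-1 @[n --> \oo] --> (1 + 0 : R)^-1 by rewrite addr0 invr1.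
  apply: cvgV; first by rewrite addr0 oner_eq0.
  by apply: cvgD; [exact: cvg_cst|apply: cvg_expr; rewrite ger0_norm].
rewrite indicE memNset//=.
have qp : 0 < q x by lra.
(* Where [1 < q x] the powers diverge, so the expression is rewritten through the powers of the
   inverse, which tend to 0. *)
have -> : (fun n => (1 + q x ^+ n)^-1) =
    (fun n => (q x)^-1 ^+ n * (1 + (q x)^-1 ^+ n)^-1).
  apply/funext => n; rewrite exprVn; have := exprn_gt0 n qp => h.
  by field; rewrite !gt_eqF//; lra.
have h : (q x)^-1 ^+ n @[n --> \oo] --> 0.
  by apply: cvg_expr; rewrite ger0_norm ?invr_ge0// invf_lt1.
suff : (q x)^-1 ^+ n * (1 + (q x)^-1 ^+ n)^-1 @[n --> \oo] --> 0 * (1 + 0 : R)^-1.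
  by rewrite mul0r.
apply: cvgM => //.
apply: cvgV; first by rewrite addr0 oner_eq0.
by apply: cvgD => //; exact: cvg_cst.
Qed.

(** The constant sequence [\1_A] converges almost everywhere to [\1_B]. *)
Lemma trig_approx_ae (A B : set R) : measurable B ->
  ae_on_circ (fun x => A x <-> B x) -> trig_approx \1_A -> trig_approx \1_B.
Proof.
move=> mB AB aA.
apply: (@trig_approx_lim _ _ v_itg v_ge0 (fun=> \1_A) _ 1) => //.
- by move=> _ x _; rewrite indicE; case: (_ \in _); rewrite ?normr1 ?normr0.
- by move=> x _; rewrite indicE; case: (_ \in _); rewrite ?normr1 ?normr0.
apply: ae_imp AB => x _ [ab ba].
have -> : \1_B x = \1_A x :> R.
  by rewrite !indicE; congr (nat_of_bool _)%:R; apply/idP/idP;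
    rewrite !inE; [exact: ba|exact: ab].
exact: cvg_cst.
Qed.

(** Clipped to the circle, a nonempty interval has midpoint [c] and half-length [r], and up to
    endpoints a point lies in it when [cos r < cos (x - c)]. The polynomial
    [1 + (cos r - cos (x - c)) / 2] takes values in [0, 2] and crosses 1 exactly there. The
    endpoints of the interval and of the circle form a null set. *)
Lemma trig_approx_indic_itvoc (a b : R) : trig_approx \1_`]a, b]%classic.
Proof.
have pi0 := pi_gt0 R.
pose a' := Num.max a (- pi); pose b' := Num.min b pi.
have aa' : a <= a' by rewrite le_max lexx.
have pa' : - pi <= a' by rewrite le_max lexx orbT.
have bb' : b' <= b by rewrite ge_min lexx.
have pb' : b' <= pi by rewrite ge_min lexx orbT.
have E x : - pi < x < pi -> (`]a, b]%classic x <-> a' < x <= b').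
  move=> /andP[x1 x2]; rewrite /= in_itv/= gt_max le_min x1 (ltW x2) !andbT.
  by [].
have [ba|ab] := leP b' a'.
  apply: (@trig_approx_ae set0) => //; last first.
    rewrite indic0; exact: trig_approx_cst.
  apply: ae_imp (ae_and (@ae_notin1 _ (- pi)) (@ae_notin1 _ pi)) => x cx [/eqP h1 /eqP h2].
  split=> // /E; rewrite !lt_neqAle h2 (eq_sym (- pi)) h1/=.
  by move: cx; rewrite circE => /andP[-> ->] /(_ isT); lra.
pose c := (a' + b') / 2; pose r := (b' - a') / 2.
apply: (@trig_approx_indic_lt1 (fun x => 1 + (cos r - cos (x - c)) * 2^-1) 2).
- apply: real_trigD; first exact: real_trig_cst.
  apply: real_trigM; last exact: real_trig_cst.
  apply: real_trigB; [exact: real_trig_cst|exact: real_trig_cosB].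
- move=> x; have := cos_le1 r; have := cos_geN1 r.
  have := cos_le1 (x - c); have := cos_geN1 (x - c); lra.
- exact: measurable_itv.
apply: ae_imp (ae_and (ae_and (@ae_notin1 _ (- pi)) (@ae_notin1 _ pi))
  (ae_and (@ae_notin1 _ a') (@ae_notin1 _ b'))) =>
  x cx [[/eqP h1 /eqP h2] [/eqP h3 /eqP h4]].
have xpi : - pi < x < pi.
  move: cx; rewrite circE => /andP[p1 p2].
  by rewrite !lt_neqAle h2 (eq_sym (- pi)) h1 p1 p2.
have {}E := E _ xpi.
pose y := `|x - c|.
have cosy : cos (x - c) = cos y by rewrite /y cos_norm.
have ry : r < pi \/ y <= pi.
  by rewrite /y ler_norml; have := xpi; rewrite /r /c; lra.
have r0 : 0 < r by rewrite /r; lra.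
have rpi : r <= pi by rewrite /r; lra.
have y0 : 0 <= y by exact: normr_ge0.
have [yr|ry'] := ltP y r.
  left; split.
    by apply/E; move: yr; rewrite /y ltr_norml /r /c; lra.
  have : cos r < cos y by rewrite ltr_cos// in_itv/=; lra.
  by rewrite cosy; lra.
have {}ry' : r < y.
  rewrite lt_neqAle ry' andbT; apply/negP => /eqP ryE.
  move: ryE; rewrite /y; case: (ger0P (x - c)) => _ h.
    by move/eqP: h4; apply; move: h; rewrite /r /c; lra.
  by move/eqP: h3; apply; move: h; rewrite /r /c; lra.
right; split.
  move=> /E ab'; suff : y <= r by lra.
  by rewrite /y ler_norml /r /c; lra.
suff : cos y < cos r by rewrite cosy; lra.
(* An interval off centre has points of the circle at distance more than [pi] from [c]. For these,
   [cos y = cos (2 pi - y)], and [r < 2 pi - y < pi] because the interval stays within the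
   circle. *)
have [ypi|piy] := leP y pi; first by rewrite ltr_cos// in_itv/=; lra.
have -> : cos y = cos (pi *+ 2 - y) by rewrite cosB cos2pi sin2pi; ring.
have y2 : y < pi *+ 2 - r.
  by rewrite mulr2n /y ltr_norml /r /c; lra.
rewrite mulr2n in y2 *.
by rewrite ltr_cos ?in_itv/=; lra.
Qed.

(** A pi-lambda argument: half-open intervals are stable under intersection and generate the Borel
    sets, while the approximable sets form a lambda-system, with proper differences by linearity and
    increasing unions by [trig_approx_lim]. *)
Lemma trig_approx_indic (A : set R) : measurable A -> trig_approx \1_A.
Proof.
pose H := [set A : set R | measurable A /\ trig_approx \1_A].
suff : <<s @ocitv R >> `<=` H by move=> sH /sH[].
have setDE (B C : set R) : C `<=` B ->
    \1_(B `\` C) = (fun x => \1_B x - \1_C x) :> (R -> R).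
  move=> CB; apply/funext => x; rewrite !indicE in_setD.
  have [xC|xC] := boolP (x \in C); last by rewrite andbT subr0.
  have -> : x \in B by rewrite inE; apply: CB; rewrite inE in xC.
  by rewrite subrr.
apply: lambda_system_subset; [exact: ocitvI|split| | by []].
- by [].
- by split; [exact: measurableT|rewrite indicT; exact: trig_approx_cst].
- move=> B C CB [mB aB] [mC aC]; split; first exact: measurableD.
  by rewrite setDE//; exact: trig_approxB.
- move=> F ndF HF; have mF : measurable (\bigcup_n F n).
    by apply: bigcup_measurable => n _; exact: (HF n).1.
  split=> //.
  apply: (@trig_approx_lim _ _ v_itg v_ge0 (fun n => \1_(F n)) _ 1).
  + by move=> n; exact: (HF n).2.
  + exact: measurable_indic.
  + by move=> n x _; rewrite indicE; case: (_ \in _); rewrite ?normr1 ?normr0.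
  + by move=> x _; rewrite indicE; case: (_ \in _); rewrite ?normr1 ?normr0.
  apply: ae_true => x _; rewrite indicE.
  have [/set_mem[n _ Fnx]|nF] := boolP (x \in \bigcup_n F n).
    apply: (@cvg_near_cst _ _ _ _ _) => //.
    exists n => // m /= nm; rewrite indicE mem_set//.
    by have /subsetPset := ndF _ _ nm; apply.
  apply: (@cvg_near_cst _ _ _ _ _) => //.
  apply: nearW => n; rewrite indicE memNset// => Fnx.
  by move/negP: nF; apply; rewrite inE; exists n.
move=> _ [[a b] _ <-]; split; first exact: measurable_itv.
exact: trig_approx_indic_itvoc.
Qed.

Import HBSimple HBNNSimple.

(** Shifted by its bound, the function becomes nonnegative on the circle and is there a limit of
    simple functions below it, which are finite combinations of indicators. *)
Lemma trig_approx_bdd u : bdd_measurable u -> trig_approx u.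
Proof.
move=> [mu1 [K uK]].
have K0 : 0 <= K.
  have cp : circ pi by rewrite circE lexx andbT; have := pi_gt0 R; lra.
  by rewrite (le_trans _ (uK _ cp)).
pose w x := u x + K.
suff : trig_approx w.
  move=> aw; have -> : u = (fun x => w x - K).
    by apply/funext => x; rewrite /w addrK.
  by apply: trig_approxB => //; exact: trig_approx_cst.
have w0 x : circ x -> 0 <= w x by move=> /uK; rewrite ler_norml /w; lra.
have wK x : circ x -> w x <= K + K by move=> /uK; rewrite ler_norml /w; lra.
have mw : measurable_fun circ w.
  by apply: measurable_funD => //; exact: measurable_cst.
have mwE : measurable_fun circ (EFin \o w) by exact/measurable_EFinP.
have w0E x : circ x -> (0 <= (EFin \o w) x)%E by move=> cx; rewrite /= lee_fin w0.
pose g := nnsfun_approx measurable_circ mwE.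
have gw n x : circ x -> g n x <= w x.
  move=> cx; rewrite -lee_fin /g nnsfun_approxE.
  exact: (@le_approx _ _ _ circ (EFin \o w) n x w0E cx).
apply: (@trig_approx_lim _ _ v_itg v_ge0 (fun n => (g n : R -> R)) _ (K + K)) => //.
- move=> n.
  have -> : (g n : R -> R) = (fun x => \sum_(y <- finmap.enum_fset (fset_set (range (g n))))
      y * \1_(g n @^-1` [set y]) x).
    by apply/funext => x; rewrite fimfunE fsbig_finite.
  elim: (finmap.enum_fset _) => [|y s ih].
    by under [fun x => _]funext do rewrite big_nil; exact: trig_approx_cst.
  under [fun x => _]funext do rewrite big_cons.
  apply: trig_approxD => //; apply: trig_approxZ => //.
  exact: trig_approx_indic.
- by move=> n x cx; rewrite ger0_norm// (le_trans (gw n x cx))// wK.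
- by move=> x cx; rewrite ger0_norm ?w0// wK.
apply: ae_true => x cx.
have := @cvg_nnsfun_approx _ _ _ _ measurable_circ _ mwE w0E x cx.
by move=> /fine_cvg.
Qed.

End DensityIndic.

(** * Complex integrals and Fourier coefficients *)

Section ComplexIntegrals.
Context {R : realType}.
Local Notation mu := (@lebesgue_measure R).
Local Notation circ := (@circ R).
Local Notation C := R[i].
Local Notation Re := (@complex.Re R).
Local Notation Im := (@complex.Im R).
Implicit Types h p q : R -> C.

Lemma complex_ext (z w : C) : Re z = Re w -> Im z = Im w -> z = w.
Proof. by case: z w => [a b] [c d] /= -> ->. Qed.

Lemma ReD (z w : C) : Re (z + w) = Re z + Re w.
Proof. by case: z w => [a b] [c d]. Qed.

Lemma ImD (z w : C) : Im (z + w) = Im z + Im w.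
Proof. by case: z w => [a b] [c d]. Qed.

Lemma ReN (z : C) : Re (- z) = - Re z.
Proof. by case: z. Qed.

Lemma ImN (z : C) : Im (- z) = - Im z.
Proof. by case: z. Qed.

Lemma ReM (z w : C) : Re (z * w) = Re z * Re w - Im z * Im w.
Proof. by case: z w => [a b] [c d]. Qed.

Lemma ImM (z w : C) : Im (z * w) = Re z * Im w + Im z * Re w.
Proof. by case: z w => [a b] [c d]. Qed.

Lemma ReJ (z : C) : Re z^* = Re z.
Proof. by case: z. Qed.

Lemma ImJ (z : C) : Im z^* = - Im z.
Proof. by case: z. Qed.

Definition ReImE := (ReD, ImD, ReN, ImN, ReM, ImM, ReJ, ImJ).

Lemma normc_ge0 (z : C) : 0 <= normc z.
Proof. by case: z => a b; rewrite /normc sqrtr_ge0. Qed.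

Lemma sqr_normcE (z : C) : normc z ^+ 2 = Re z ^+ 2 + Im z ^+ 2.
Proof. by case: z => a b; rewrite /normc sqr_sqrtr// addr_ge0 ?sqr_ge0. Qed.

Lemma normc_Re (z : C) : `|Re z| <= normc z.
Proof.
rewrite -(@ler_pXn2r _ 2) ?nnegrE ?normc_ge0// sqr_normcE -normrX ger0_norm ?sqr_ge0//.
by rewrite lerDl sqr_ge0.
Qed.

Lemma normc_Im (z : C) : `|Im z| <= normc z.
Proof.
rewrite -(@ler_pXn2r _ 2) ?nnegrE ?normc_ge0// sqr_normcE -normrX ger0_norm ?sqr_ge0//.
by rewrite lerDr sqr_ge0.
Qed.

Lemma normc_le_ReIm (z : C) : normc z <= `|Re z| + `|Im z|.
Proof.
rewrite -(@ler_pXn2r _ 2) ?nnegrE ?normc_ge0 ?addr_ge0// sqr_normcE.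
rewrite -(real_normK (num_real (Re z))) -(real_normK (num_real (Im z))).
by have := mulr_ge0 (normr_ge0 (Re z)) (normr_ge0 (Im z)); nra.
Qed.

Lemma normc_real (r : R) : normc (r%:C : C) = `|r|.
Proof. by rewrite /normc/= expr0n addr0 sqrtr_sqr. Qed.

Lemma expiD x y : expi (x + y) = expi x * expi y :> C.
Proof. by apply: complex_ext; rewrite !ReImE/= ?cosD ?sinD//; ring. Qed.

Lemma expi0 : expi 0 = 1 :> C.
Proof. by rewrite /expi cos0 sin0. Qed.

Lemma normc_expi x : normc (expi x : C) = 1.
Proof. by rewrite /expi /normc cos2Dsin2 sqrtr1. Qed.

Lemma conjc_expi x : (expi x)^* = expi (- x) :> C.
Proof. by rewrite /expi cosN sinN. Qed.

Definition citg h := itg (fun x => Re (h x)) /\ itg (fun x => Im (h x)).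

Lemma citg_cmeasurable h : citg h -> cmeasurable h.
Proof. by move=> [? ?]; split; exact: itg_measurable. Qed.

Lemma citgD h p : citg h -> citg p -> citg (fun x => h x + p x).
Proof.
move=> [rh ih] [rp ip]; split.
  by under [fun x => _]funext do rewrite ReD; exact: itgD.
by under [fun x => _]funext do rewrite ImD; exact: itgD.
Qed.

Lemma citgZ c h : citg h -> citg (fun x => c * h x).
Proof.
move=> [rh ih]; split.
  by under [fun x => _]funext do rewrite ReM; apply: itgB; exact: itgZ.
by under [fun x => _]funext do rewrite ImM; apply: itgD; exact: itgZ.
Qed.

Lemma citgB h p : citg h -> citg p -> citg (fun x => h x - p x).
Proof.
move=> ch cp; under [fun x => _]funext do rewrite -mulN1r.
by apply: citgD => //; exact: citgZ.
Qed.

Lemma citg_sum I (s : seq I) (P : pred I) (h : I -> R -> C) :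
  (forall i, citg (h i)) -> citg (fun x => \sum_(i <- s | P i) h i x).
Proof.
move=> ch; elim: s => [|i s ih].
  by under [fun x => _]funext do rewrite big_nil; split; exact: itg_cst.
under [fun x => _]funext do rewrite big_cons.
by case: (P i) => //; exact: citgD.
Qed.

Lemma cintegralE h :
  cintegral h = circint (fun x => Re (h x)) +i* circint (fun x => Im (h x)).
Proof. by []. Qed.

Lemma cintegralD h p : citg h -> citg p ->
  cintegral (fun x => h x + p x) = cintegral h + cintegral p.
Proof.
move=> [rh ih] [rp ip]; apply: complex_ext; rewrite !ReImE !cintegralE/=.
  by rewrite -circintD//; apply: circint_eq => x _; rewrite ReD.
by rewrite -circintD//; apply: circint_eq => x _; rewrite ImD.
Qed.

Lemma cintegralZ c h : citg h ->
  cintegral (fun x => c * h x) = c * cintegral h.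
Proof.
move=> [rh ih]; apply: complex_ext; rewrite !ReImE !cintegralE/= -!circintZ//.
  rewrite -circintB; do ?[exact: itgZ].
  by apply: circint_eq => x _; rewrite ReM.
rewrite -circintD; do ?[exact: itgZ].
by apply: circint_eq => x _; rewrite ImM.
Qed.

Lemma cintegralB h p : citg h -> citg p ->
  cintegral (fun x => h x - p x) = cintegral h - cintegral p.
Proof.
move=> ch cp; rewrite -(mulN1r (cintegral p)) -cintegralZ// -cintegralD//.
  by congr cintegral; apply/funext => x; rewrite mulN1r.
exact: citgZ.
Qed.

Lemma cintegral_sum I (s : seq I) (P : pred I) (h : I -> R -> C) :
  (forall i, citg (h i)) ->
  cintegral (fun x => \sum_(i <- s | P i) h i x) =
  \sum_(i <- s | P i) cintegral (h i).
Proof.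
move=> ch; elim: s => [|i s ih].
  rewrite big_nil; under [fun x => _]funext do rewrite big_nil.
  by rewrite cintegralE/= circint_cst mul0r.
rewrite big_cons; under [fun x => _]funext do rewrite big_cons.
by case: (P i) => //; rewrite cintegralD ?ih//; exact: citg_sum.
Qed.

Lemma cintegral_ae h p : cmeasurable h -> cmeasurable p ->
  ae_on_circ (fun x => h x = p x) -> cintegral h = cintegral p.
Proof.
move=> [rh ih] [rp ip] hp; apply: complex_ext; rewrite !cintegralE/=;
  by apply: circint_ae => //; apply: ae_imp hp => x _ ->.
Qed.

Lemma cmeasurableD h p : cmeasurable h -> cmeasurable p ->
  cmeasurable (fun x => h x + p x).
Proof.
move=> [rh ih] [rp ip]; split.
  by under [fun x => _]funext do rewrite ReD; exact: measurable_funD.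
by under [fun x => _]funext do rewrite ImD; exact: measurable_funD.
Qed.

Lemma cmeasurableM h p : cmeasurable h -> cmeasurable p ->
  cmeasurable (fun x => h x * p x).
Proof.
move=> [rh ih] [rp ip]; split.
  under [fun x => _]funext do rewrite ReM.
  by apply: measurable_funB; exact: measurable_funM.
under [fun x => _]funext do rewrite ImM.
by apply: measurable_funD; exact: measurable_funM.
Qed.

Lemma cmeasurable_cst (c : C) : cmeasurable (fun=> c).
Proof. by split; exact: measurable_cst. Qed.

Lemma cmeasurableB h p : cmeasurable h -> cmeasurable p ->
  cmeasurable (fun x => h x - p x).
Proof.
move=> ch cp; under [fun x => _]funext do rewrite -mulN1r.
by apply: cmeasurableD => //; apply: cmeasurableM => //; exact: cmeasurable_cst.
Qed.

Lemma cmeasurable_real (u : R -> R) : measurable_fun circ u ->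
  cmeasurable (fun x => (u x)%:C).
Proof. by move=> mu1; split => //=; exact: measurable_cst. Qed.

Lemma measurable_normc h : cmeasurable h -> measurable_fun circ (fun x => normc (h x)).
Proof.
move=> [rh ih].
have -> : (fun x => normc (h x)) = (fun x => (normc (h x) ^+ 2) `^ 2^-1).
  by apply/funext => x; rewrite powR12_sqrt ?sqr_ge0// sqrtr_sqr ger0_norm ?normc_ge0.
apply: (@measurableT_comp _ _ _ _ _ _ (@powR R ^~ 2^-1)) => //.
under [fun x => _]funext do rewrite sqr_normcE.
by apply: measurable_funD; exact: measurable_funX.
Qed.

Lemma citg_le h (v : R -> R) : cmeasurable h -> itg v ->
  ae_on_circ (fun x => normc (h x) <= v x) -> citg h.
Proof.
move=> [rh ih] iv hv; split.
- by apply: itg_le_ae iv _ => //;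
    apply: ae_imp hv => x _; apply: le_trans; exact: normc_Re.
- by apply: itg_le_ae iv _ => //;
    apply: ae_imp hv => x _; apply: le_trans; exact: normc_Im.
Qed.

Lemma citg_normc h : citg h -> itg (fun x => normc (h x)).
Proof.
move=> ch; have [rh ih] := ch.
apply: (@itg_le _ _ (fun x => `|Re (h x)| + `|Im (h x)|)).
- by apply: measurable_normc; exact: citg_cmeasurable.
- by apply: itgD; exact: integrable_norm.
- by move=> x _; rewrite ger0_norm ?normc_ge0// normc_le_ReIm.
Qed.

(** The real and imaginary parts are bounded separately, whence the factor 2; a crude constant
    suffices for the smallness arguments below. *)
Lemma normc_cintegral h : citg h ->
  normc (cintegral h) <= 2 * circint (fun x => normc (h x)).
Proof.
move=> ch; have [rh ih] := ch; apply: le_trans (normc_le_ReIm _) _.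
rewrite cintegralE/= mulr_natl mulr2n; apply: lerD.
  apply: le_trans (circint_norm rh) _; apply: circint_le => [||x _].
  - exact: integrable_norm.
  - exact: citg_normc.
  - exact: normc_Re.
apply: le_trans (circint_norm ih) _; apply: circint_le => [||x _].
- exact: integrable_norm.
- exact: citg_normc.
- exact: normc_Im.
Qed.

Lemma measurable_cos (a : R) : measurable_fun circ (fun x => cos (a * x)).
Proof.
apply: measurable_funTS; apply: (measurableT_comp (f := @cos R)).
  by apply: continuous_measurable_fun; exact: continuous_cos.
by apply: measurable_funM => //; exact: measurable_cst.
Qed.

Lemma measurable_sin (a : R) : measurable_fun circ (fun x => sin (a * x)).
Proof.
apply: measurable_funTS; apply: (measurableT_comp (f := @sin R)).
  by apply: continuous_measurable_fun; exact: continuous_sin.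
by apply: measurable_funM => //; exact: measurable_cst.
Qed.

Lemma cmeasurable_expi (a : R) : cmeasurable (fun x => expi (a * x)).
Proof. by split; [exact: measurable_cos|exact: measurable_sin]. Qed.

Lemma citgM_expi h (a : R) : citg h -> citg (fun x => h x * expi (a * x)).
Proof.
move=> ch; apply: citg_le (citg_normc ch) _.
  by apply: cmeasurableM; [exact: citg_cmeasurable|exact: cmeasurable_expi].
by apply: ae_true => x _; rewrite normcM normc_expi mulr1.
Qed.

Lemma citg_cst (c : C) : citg (fun=> c).
Proof. by split; exact: itg_cst. Qed.

Lemma citg_expi (a : R) : citg (fun x => expi (a * x)).
Proof.
have := citgM_expi a (citg_cst 1).
by under [fun x => _]funext do rewrite mul1r.
Qed.

Lemma circint_derive (f F : R -> R) : continuous f ->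
  (forall x : R, is_derive x (1 : R) F (f x)) -> circint f = F pi - F (- pi).
Proof.
move=> cf dF; have pi0 := pi_gt0 R.
have cF : continuous F.
  by move=> x; apply: differentiable_continuous; apply/derivable1_diffP; case: (dF x).
rewrite /circint /Rintegral (@continuous_FTC2 _ f F (- pi) pi) => [//||||].
- lra.
- exact: continuous_subspaceT.
- split.
  + by move=> x _; case: (dF x).
  + by apply: cvg_at_right_filter; exact: cF.
  + by apply: cvg_at_left_filter; exact: cF.
- by move=> x _; rewrite derive1E; case: (dF x).
Qed.

Lemma sin_intpi (j : int) : sin (j%:~R * pi) = 0 :> R.
Proof.
have natP (n : nat) : sin (n%:R * pi) = 0 :> R.
  elim: n => [|n ih]; first by rewrite mul0r sin0.
  by rewrite -natr1 mulrDl mul1r sinDpi ih oppr0.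
case: j => n; first exact: natP.
by rewrite NegzE mulrNz mulNr sinN -[_%:~R]/(n.+1%:R) natP oppr0.
Qed.

(** Orthogonality of the exponentials. For [j != 0] the primitives agree at both ends: the sine
    vanishes at multiples of [pi], the cosine is even. *)
Lemma cintegral_expi (j : int) :
  cintegral (fun x => expi (j%:~R * x)) = ((if j == 0 then 2 * pi else 0) : R)%:C.
Proof.
case: eqP => [->|/eqP j0].
  rewrite cintegralE /=; under [fun x => cos _]funext do rewrite mul0r cos0.
  under [fun x => sin _]funext do rewrite mul0r sin0.
  by rewrite !circint_cst mul0r mul1r.
have jR : j%:~R != 0 :> R by rewrite intr_eq0.
have cl : continuous (fun x : R => j%:~R * x).
  by move=> x; apply: cvgM; [exact: cvg_cst|exact: cvg_id].
have dl (x : R) : is_derive x (1 : R) (fun x : R => j%:~R * x) j%:~R.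
  have := is_deriveZ (j%:~R : R) (is_derive_id x (1 : R)).
  by rewrite /GRing.scale/= mulr1.
rewrite cintegralE/=; congr (_ +i* _).
  rewrite (_ : circint _ = j%:~R^-1 * sin (j%:~R * pi) - j%:~R^-1 * sin (j%:~R * - pi)).
    by rewrite !mulrN sinN sin_intpi; ring.
  apply: (@circint_derive _ (fun x => j%:~R^-1 * sin (j%:~R * x))).
    by move=> x; apply: continuous_comp; [exact: cl|exact: continuous_cos].
  move=> x; have := is_deriveZ (j%:~R^-1 : R)
    (is_derive1_comp (is_derive_sin (j%:~R * x)) (dl x)).
  by rewrite /GRing.scale/= mulrC mulfK.
rewrite (_ : circint _ = - j%:~R^-1 * cos (j%:~R * pi) - - j%:~R^-1 * cos (j%:~R * - pi)).
  by rewrite !mulrN cosN; ring.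
apply: (@circint_derive _ (fun x => - j%:~R^-1 * cos (j%:~R * x))).
  by move=> x; apply: continuous_comp; [exact: cl|exact: continuous_sin].
move=> x; have := is_deriveZ (- j%:~R^-1 : R)
  (is_derive1_comp (is_derive_cos (j%:~R * x)) (dl x)).
by rewrite /GRing.scale/= mulNr mulNr mulrN opprK mulrC mulfK.
Qed.

End ComplexIntegrals.

(** * Trigonometric sums and their Fourier coefficients *)

Section TrigSums.
Context {R : realType}.
Local Notation mu := (@lebesgue_measure R).
Local Notation circ := (@circ R).
Local Notation C := R[i].
Local Notation Re := (@complex.Re R).
Local Notation Im := (@complex.Im R).
Implicit Types h p q : R -> C.

(** Frequencies may repeat in the list, so that sums are concatenations and products need no
    collection of equal terms. *)
Definition trig_sum (s : seq (int * C)) (x : R) : C :=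
  \sum_(y <- s) y.2 * expi (y.1%:~R * x).

Lemma trig_sum_cat s t x : trig_sum (s ++ t) x = trig_sum s x + trig_sum t x.
Proof. by rewrite /trig_sum big_cat. Qed.

Lemma trig_sum_cons y s x :
  trig_sum (y :: s) x = y.2 * expi (y.1%:~R * x) + trig_sum s x.
Proof. by rewrite /trig_sum big_cons. Qed.

Lemma trig_sumZ c s x :
  trig_sum [seq (y.1, c * y.2) | y <- s] x = c * trig_sum s x.
Proof.
rewrite /trig_sum big_map mulr_sumr.
by apply: eq_bigr => y _; rewrite mulrA.
Qed.

Lemma trig_sumM s t : exists r, forall x,
  trig_sum r x = trig_sum s x * trig_sum t x.
Proof.
elim: s => [|y s [r rE]].
  by exists [::] => x; rewrite /trig_sum !big_nil mul0r.
exists ([seq (y.1 + z.1, y.2 * z.2) | z <- t] ++ r) => x.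
rewrite trig_sum_cat rE trig_sum_cons mulrDl; congr (_ + _).
rewrite /trig_sum big_map mulr_sumr; apply: eq_bigr => z _ /=.
by rewrite rmorphD/= mulrDl expiD; ring.
Qed.

Lemma real_trig_sum_exp (p : R -> R) : real_trig p ->
  exists s, forall x, (p x)%:C = trig_sum s x.
Proof.
elim=> [c| | |p1 p2 _ [s sE] _ [t tE]|p1 p2 _ [s sE] _ [t tE]].
- exists [:: (0, c%:C)] => x.
  by rewrite /trig_sum big_seq1 mul0r expi0 mulr1.
- exists [:: (1, (2^-1)%:C); (-1, (2^-1)%:C)] => x.
  rewrite /trig_sum big_cons big_seq1/= !mulrNz !mulr1z mulN1r mul1r.
  by apply: complex_ext; rewrite !ReImE/= ?cosN ?sinN; field.
- exists [:: (1, 0 +i* - 2^-1); (-1, 0 +i* 2^-1)] => x.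
  rewrite /trig_sum big_cons big_seq1/= !mulrNz !mulr1z mulN1r mul1r.
  by apply: complex_ext; rewrite !ReImE/= ?cosN ?sinN; field.
- by exists (s ++ t) => x; rewrite trig_sum_cat -sE -tE rmorphD.
- have [r rE] := trig_sumM s t.
  by exists r => x; rewrite rE -sE -tE rmorphM.
Qed.

Lemma citg_trig_sum s : citg (trig_sum s).
Proof.
by apply: citg_sum => y; apply: citgZ; exact: citg_expi.
Qed.

(** [observed_span] takes coefficients from a function of the frequency, whereas a list of pairs may
    give several to one frequency. They are added up, and [undup] makes each frequency count
    once. *)
Lemma observed_spanE N (p : R -> C) : observed_span N p <->
  exists s : seq (int * C),
    (forall y, y \in s -> ~~ (0 <= y.1 <= N%:Z)) /\ p = trig_sum s.
Proof.
split=> [[s [c [sN ->]]]|[s [sN ->]]].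
  exists [seq (j, c j) | j <- s]; split.
    by move=> _ /mapP[j /sN jN ->].
  by apply/funext => x; rewrite /trig_sum big_map.
exists (undup (unzip1 s)), (fun j => \sum_(y <- s | y.1 == j) y.2); split.
  by move=> j; rewrite mem_undup => /mapP[y /sN yN ->].
apply/funext => x; rewrite /trig_sum.
under [RHS]eq_bigr do rewrite mulr_suml.
rewrite (exchange_big_dep xpredT)//= big_seq [RHS]big_seq; apply: eq_bigr => y ys.
under eq_bigl do rewrite eq_sym.
rewrite -big_filter filter_pred1_uniq ?big_seq1 ?undup_uniq//.
by rewrite mem_undup; apply: map_f.
Qed.

Lemma trig_sum_split N s : exists q (r : 'cV[C]_N.+1),
  observed_span N q /\ forall x, trig_sum s x = q x + trig_poly r x.
Proof.
pose P (y : int * C) := 0 <= y.1 <= N%:Z.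
exists (trig_sum [seq y <- s | ~~ P y]).
exists (\col_(k < N.+1) \sum_(y <- s | y.1 == k%:Z) y.2); split.
  by apply/observed_spanE; exists [seq y <- s | ~~ P y]; split=> // y;
    rewrite mem_filter => /andP[].
move=> x; rewrite /trig_sum (bigID P)/= addrC big_filter; congr (_ + _).
rewrite /trig_poly; under [RHS]eq_bigr do rewrite mxE mulr_suml.
rewrite (exchange_big_dep P)/=; last first.
  move=> k y _ /eqP yk; rewrite /P yk; have := ltn_ord k.
  by rewrite ltnS.
apply: eq_bigr => y /andP[y0 yN].
have yE : y.1 = `|y.1|%N%:Z by rewrite gez0_abs.
have yN' : (`|y.1| < N.+1)%N by rewrite ltnS -lez_nat -yE.
rewrite (big_pred1 (Ordinal yN'))/= => [|k].
  by rewrite {1}yE.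
by rewrite {1}yE eqz_nat; exact: eq_sym.
Qed.

(** Unnormalised: the factor [(2 * pi)^-1] is left out and reappears as [2 * pi] in the coefficients
    of trigonometric sums. *)
Definition fourier h (k : nat) : C :=
  cintegral (fun x => h x * expi (- k%:R * x)).

Lemma fourierD h p k : citg h -> citg p ->
  fourier (fun x => h x + p x) k = fourier h k + fourier p k.
Proof.
move=> ch cp; rewrite -cintegralD; do ?exact: citgM_expi.
by congr cintegral; apply/funext => x; rewrite mulrDl.
Qed.

Lemma fourierB h p k : citg h -> citg p ->
  fourier (fun x => h x - p x) k = fourier h k - fourier p k.
Proof.
move=> ch cp; rewrite -cintegralB; do ?exact: citgM_expi.
by congr cintegral; apply/funext => x; rewrite mulrBl.
Qed.

Lemma fourier_trig_sum s k :
  fourier (trig_sum s) k = (2 * pi)%:C * \sum_(y <- s | y.1 == k%:Z) y.2.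
Proof.
rewrite /fourier.
have -> : (fun x => trig_sum s x * expi (- k%:R * x)) =
    (fun x => \sum_(y <- s) y.2 * expi ((y.1 - k%:Z)%:~R * x)).
  apply/funext => x; rewrite /trig_sum mulr_suml; apply: eq_bigr => y _.
  by rewrite -mulrA -expiD rmorphB/= mulrDl.
rewrite cintegral_sum; last by move=> y; apply: citgZ; exact: citg_expi.
rewrite mulr_sumr [RHS]big_mkcond/=; apply: eq_bigr => y _.
rewrite cintegralZ ?cintegral_expi; last exact: citg_expi.
by rewrite subr_eq0; case: eqP => _; [exact: mulrC|exact: mulr0].
Qed.

Lemma fourier_observed N q k : observed_span N q -> (k <= N)%N ->
  fourier q k = 0.
Proof.
move=> /observed_spanE[s [sN ->]] kN; rewrite fourier_trig_sum.
rewrite big_seq_cond big_pred0 ?mulr0// => y.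
apply/negP => /andP[/sN + /eqP yk].
by rewrite yk lez_nat kN.
Qed.

Lemma trig_polyE N (r : 'cV[C]_N.+1) :
  trig_poly r = trig_sum [seq (Posz k, r k 0) | k : 'I_N.+1 <- enum 'I_N.+1].
Proof.
by apply/funext => x; rewrite /trig_sum big_map big_enum.
Qed.

Lemma fourier_trig_poly N (r : 'cV[C]_N.+1) (k : 'I_N.+1) :
  fourier (trig_poly r) k = (2 * pi)%:C * r k 0.
Proof.
rewrite trig_polyE fourier_trig_sum big_map big_enum_cond/=.
by rewrite (big_pred1 k)// => j; rewrite eqz_nat.
Qed.

Lemma citg_observed N q : observed_span N q -> citg q.
Proof. by move=> /observed_spanE[s [_ ->]]; exact: citg_trig_sum. Qed.

Lemma citg_trig_poly N (r : 'cV[C]_N.+1) : citg (trig_poly r).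
Proof. by rewrite trig_polyE; exact: citg_trig_sum. Qed.

Lemma normc_trig_sum s x : normc (trig_sum s x) <= \sum_(y <- s) normc y.2.
Proof.
rewrite /trig_sum; elim: s => [|y s ih]; first by rewrite !big_nil normc0.
rewrite !big_cons (le_trans (le_normcD _ _))// lerD// normcM normc_expi.
by rewrite mulr1.
Qed.

Lemma normc_trig_poly N (r : 'cV[C]_N.+1) x :
  normc (trig_poly r x) <= \sum_(k < N.+1) normc (r k 0).
Proof. by rewrite trig_polyE (le_trans (normc_trig_sum _ _))// big_map big_enum. Qed.

Lemma normc_fourier h k : citg h ->
  normc (fourier h k) <= 2 * circint (fun x => normc (h x)).
Proof.
move=> ch; apply: le_trans (normc_cintegral (citgM_expi _ ch)) _.
rewrite ler_pM2l//; apply: circint_le.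
- by apply: citg_normc; exact: citgM_expi.
- exact: citg_normc.
- by move=> x _; rewrite normcM normc_expi mulr1.
Qed.

(* Integrate [0 <= (f - m / w)^2 w]. *)
Lemma cauchy_schwarz_param (f w : R -> R) (m : R) :
  itg f -> itg (fun x => f x ^+ 2 * w x) -> itg (fun x => (w x)^-1) ->
  ae_on_circ (fun x => 0 < w x) ->
  2 * m * circint f <=
    circint (fun x => f x ^+ 2 * w x) + m ^+ 2 * circint (fun x => (w x)^-1).
Proof.
move=> itf itfw itw w0; have iD := itgD itfw (itgZ (m ^+ 2) itw).
rewrite -!circintZ// -circintD//; last exact: itgZ.
rewrite -subr_ge0 -circintB//; last exact: itgZ.
(* The completed square is known to be nonnegative only where [0 < w x]. The maximum with 0 changes
   the integrand on a null set and makes it nonnegative everywhere. *)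
rewrite (@circint_ae _ _
    (fun x => Num.max 0 (f x ^+ 2 * w x + m ^+ 2 * (w x)^-1 - 2 * m * f x))).
- by apply: circint_ge0 => x _; rewrite le_max lexx.
- by apply: itg_measurable; apply: itgB => //; exact: itgZ.
- apply: measurable_maxr; first exact: measurable_cst.
  by apply: itg_measurable; apply: itgB => //; exact: itgZ.
apply: ae_imp w0 => x _ w0; apply/esym/max_idPr.
have -> : f x ^+ 2 * w x + m ^+ 2 * (w x)^-1 - 2 * m * f x =
    (f x - m / w x) ^+ 2 * w x by field; rewrite gt_eqF.
by rewrite mulr_ge0 ?sqr_ge0// ltW.
Qed.

(** The parametric inequality with unit weight, at its best parameter: the mean of [f]. *)
Lemma sqr_circint_le (f : R -> R) : itg f -> itg (fun x => f x ^+ 2) ->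
  circint f ^+ 2 <= 2 * pi * circint (fun x => f x ^+ 2).
Proof.
move=> itf itf2.
have [P PE P0] : exists2 P : R, P = 2 * pi & 0 < P.
  by exists (2 * pi) => //; rewrite mulr_gt0// pi_gt0.
have := @cauchy_schwarz_param f (fun=> 1) (circint f / P) itf.
under [fun x => f x ^+ 2 * 1]funext do rewrite mulr1.
under [fun x => 1^-1]funext do rewrite invr1.
move=> /(_ itf2 (@itg_cst _ _) (ae_true (fun _ _ => ltr01))).
rewrite circint_cst mul1r -PE.
have -> : 2 * (circint f / P) * circint f = 2 * (circint f ^+ 2 / P).
  by field; rewrite gt_eqF.
have -> : (circint f / P) ^+ 2 * P = circint f ^+ 2 / P.
  by field; rewrite gt_eqF.
move=> h; suff : circint f ^+ 2 / P <= circint (fun x => f x ^+ 2).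
  by rewrite ler_pdivrMr// (mulrC _ P).
lra.
Qed.

Lemma sqdistE (w : R -> R) h p :
  itg (fun x => normc (h x - p x) ^+ 2 * w x) ->
  sqdist w h p = (circint (fun x => normc (h x - p x) ^+ 2 * w x))%:E.
Proof. by move=> i; rewrite EFin_circint. Qed.

End TrigSums.

(** * Functions whose coefficients at 0, ..., N vanish *)

Section WeightedSpan.
Context {R : realType}.
Local Notation mu := (@lebesgue_measure R).
Local Notation circ := (@circ R).
Local Notation C := R[i].
Local Notation Re := (@complex.Re R).
Local Notation Im := (@complex.Im R).
Implicit Types h p q : R -> C.

Lemma itg_normc2 p (v : R -> R) K : cmeasurable p ->
  ae_on_circ (fun x => normc (p x) <= K) -> itg v ->
  itg (fun x => normc (p x) ^+ 2 * v x).
Proof.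
move=> mp pK iv; have mn := measurable_normc mp.
apply: (@itg_le_ae _ _ (fun x => K ^+ 2 * `|v x|)).
- by apply: measurable_funM; [exact: measurable_funX|exact: itg_measurable].
- by apply: itgZ; exact: integrable_norm.
apply: ae_imp pK => x _ pK; rewrite normrM normrX ler_wpM2r//.
rewrite ger0_norm ?normc_ge0// lerXn2r ?nnegrE ?normc_ge0//.
by rewrite (le_trans _ pK) ?normc_ge0.
Qed.

Lemma normcD_sqr (z w : C) : normc (z + w) ^+ 2 <= 2 * normc z ^+ 2 + 2 * normc w ^+ 2.
Proof.
rewrite !sqr_normcE !ReImE.
by have := sqr_ge0 (Re z - Re w); have := sqr_ge0 (Im z - Im w); nra.
Qed.

Lemma trig_sum_dense (v : R -> R) h K e : itg v -> (forall x, circ x -> 0 <= v x) ->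
  cmeasurable h -> (forall x, circ x -> normc (h x) <= K) -> 0 < e ->
  exists s, circint (fun x => normc (h x - trig_sum s x) ^+ 2 * v x) < e.
Proof.
move=> iv v0 [rh ih] hK e0.
have bR : bdd_measurable (fun x => Re (h x)).
  by split=> //; exists K => x cx; apply: le_trans (normc_Re _) (hK x cx).
have bI : bdd_measurable (fun x => Im (h x)).
  by split=> //; exists K => x cx; apply: le_trans (normc_Im _) (hK x cx).
have [_ /(_ (e / 2) ltac:(lra)) [p tp hp]] := trig_approx_bdd iv v0 bR.
have [_ /(_ (e / 2) ltac:(lra)) [q tq hq]] := trig_approx_bdd iv v0 bI.
have [s sE] := real_trig_sum_exp tp; have [t tE] := real_trig_sum_exp tq.
exists (s ++ [seq (y.1, (0 +i* 1) * y.2) | y <- t]).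
suff -> : circint (fun x => normc (h x -
    trig_sum (s ++ [seq (y.1, (0 +i* 1) * y.2) | y <- t]) x) ^+ 2 * v x) =
  dist2 v (fun x => Re (h x)) p + dist2 v (fun x => Im (h x)) q by lra.
rewrite -circintD.
- apply: circint_eq => x _; rewrite trig_sum_cat trig_sumZ -sE -tE.
  by rewrite sqr_normcE !ReImE/=; ring.
- by apply: dist2_itg => //; exact: bdd_measurable_trig.
- by apply: dist2_itg => //; exact: bdd_measurable_trig.
Qed.

(** The dual description of L_2^N, free of any weight, so that the characteristic of one pair of
    densities can be tested against another pair. *)
Definition vanishes N h :=
  citg h /\ forall k : nat, (k <= N)%N -> fourier h k = 0.

Lemma measurable_sqdist (w : R -> R) h p : measurable_fun circ w ->
  cmeasurable h -> cmeasurable p ->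
  measurable_fun circ (fun x => normc (h x - p x) ^+ 2 * w x).
Proof.
move=> mw mh mp; apply: measurable_funM => //; apply: measurable_funX.
by apply: measurable_normc; exact: cmeasurableB.
Qed.

Lemma sqdist_ae (w : R -> R) h h' p : measurable_fun circ w ->
  cmeasurable h -> cmeasurable h' -> cmeasurable p ->
  ae_on_circ (fun x => h x = h' x) -> sqdist w h p = sqdist w h' p.
Proof.
move=> mw mh mh' mp hh'; rewrite /sqdist; apply: ae_eq_integral => //.
- exact: (measurable_EFin (measurable_sqdist mw mh mp)).
- exact: (measurable_EFin (measurable_sqdist mw mh' mp)).
suff : ae_on_circ (fun x => (normc (h x - p x) ^+ 2 * w x)%:E =
                            (normc (h' x - p x) ^+ 2 * w x)%:E) by [].
by apply: ae_imp hh' => x _ ->.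
Qed.

(* Remove from a trigonometric sum close to [h] its frequencies in [0, N]:
   their coefficients are those of the difference with [h], hence small. *)
Lemma vanishing_approx N (w : R -> R) h K e : itg w ->
  (forall x, circ x -> 0 <= w x) -> vanishes N h ->
  (forall x, circ x -> normc (h x) <= K) -> 0 < e ->
  exists2 q, observed_span N q & (sqdist w h q < e%:E)%E.
Proof.
move=> iw w0 [ch vh] hK e0; have mh := citg_cmeasurable ch.
pose W := circint w.
have W0 : 0 <= W by exact: circint_ge0.
(* [K0] collects the cost of passing from the trigonometric sum to [q]: 2 multiplies its squared
   distance to [h] in the weight [w], and the rest bounds twice the weighted norm of the removed
   polynomial, whose modulus is at most [N.+1%:R * F] with [F ^+ 2 <= 2 * pi * E2]. *)
pose K0 := 2 + 4 * N.+1%:R ^+ 2 * pi * W.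
have K00 : 0 < K0.
  by rewrite ltr_pwDl// !mulr_ge0// pi_ge0.
(* Closeness in the weight [w] serves the final estimate; closeness in the weight 1 controls the
   Fourier coefficients of the difference. *)
have iw1 : itg (fun x => w x + 1) by apply: itgD => //; exact: itg_cst.
have [s sE] := trig_sum_dense iw1 (fun x cx => addr_ge0 (w0 x cx) ler01) mh hK
  (divr_gt0 e0 K00).
have [q [r [oq sqr]]] := trig_sum_split N s.
have cs := @citg_trig_sum _ s; have ms := citg_cmeasurable cs.
have cd : citg (fun x => h x - trig_sum s x) by exact: citgB.
have md := citg_cmeasurable cd.
have cq := citg_observed oq.
pose d x := normc (h x - trig_sum s x).
have dB : ae_on_circ (fun x => d x <= K + \sum_(y <- s) normc y.2).
  apply: ae_true => x cx; rewrite /d (le_trans (le_normcD _ _))// normcN.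
  by rewrite lerD ?hK// normc_trig_sum.
have id2w : itg (fun x => d x ^+ 2 * w x) by exact: itg_normc2 dB iw.
have id2 : itg (fun x => d x ^+ 2).
  have := itg_normc2 md dB (@itg_cst _ 1).
  by under [fun x => _]funext do rewrite mulr1.
have Esum : circint (fun x => d x ^+ 2 * w x) + circint (fun x => d x ^+ 2) < e / K0.
  rewrite -circintD//; apply: le_lt_trans sE.
  rewrite le_eqVlt; apply/orP; left; apply/eqP.
  by apply: circint_eq => x _; rewrite mulrDr mulr1.
set E1 := circint _ in Esum; set E2 := circint _ in Esum.
have E10 : 0 <= E1 by apply: circint_ge0 => x cx; rewrite mulr_ge0 ?sqr_ge0 ?w0.
have E20 : 0 <= E2 by apply: circint_ge0 => x cx; rewrite sqr_ge0.
pose F := circint d.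
have F0 : 0 <= F by apply: circint_ge0 => x _; exact: normc_ge0.
have FE : F ^+ 2 <= 2 * pi * E2.
  by apply: sqr_circint_le => //; exact: citg_normc.
have rF k : normc (r k 0) <= F.
  have kN : (k <= N)%N by rewrite -ltnS ltn_ord.
  have : (2 * pi)%:C * r k 0 = - fourier (fun x => h x - trig_sum s x) k.
    rewrite -fourier_trig_poly fourierB// vh// sub0r opprK.
    rewrite (_ : trig_sum s = fun x => q x + trig_poly r x); last exact/funext.
    rewrite fourierD//; last exact: citg_trig_poly.
    by rewrite (fourier_observed oq)// add0r.
  move=> /(congr1 (@normc R)); rewrite normcM normcN.
  have := normc_fourier k cd; rewrite -/d -/F => h1 h2; move: h1; rewrite -h2.
  have -> : normc (2 * pi)%:C = 2 * pi :> R.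
    by rewrite normc_real ger0_norm// mulr_ge0// pi_ge0.
  by have := normc_ge0 (r k 0); have := pi_ge2 R; nra.
have rB x : normc (trig_poly r x) <= N.+1%:R * F.
  apply: le_trans (normc_trig_poly _ _) _.
  by rewrite -[N.+1 in leRHS]card_ord mulr_natl -sumr_const; apply: ler_sum.
have rB2 x : normc (trig_poly r x) ^+ 2 <= N.+1%:R ^+ 2 * (2 * pi * E2).
  apply: (@le_trans _ _ ((N.+1%:R * F) ^+ 2)).
    by rewrite lerXn2r ?nnegrE ?normc_ge0// mulr_ge0.
  by rewrite exprMn ler_wpM2l// sqr_ge0.
exists q => //.
have qE x : h x - q x = (h x - trig_sum s x) + trig_poly r x by rewrite sqr; ring.
have hqB x : circ x -> normc (h x - q x) ^+ 2 * w x <=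
    2 * (d x ^+ 2 * w x) + 2 * (N.+1%:R ^+ 2 * (2 * pi * E2)) * w x.
  move=> cx; rewrite mulrA -mulrDl ler_wpM2r ?w0// qE.
  by rewrite (le_trans (normcD_sqr _ _))// lerD2l ler_pM2l.
have iU : itg (fun x => 2 * (d x ^+ 2 * w x) + 2 * (N.+1%:R ^+ 2 * (2 * pi * E2)) * w x).
  by apply: itgD; exact: itgZ.
have ihq : itg (fun x => normc (h x - q x) ^+ 2 * w x).
  apply: itg_le iU _.
    apply: measurable_sqdist => //; first exact: itg_measurable.
    exact: citg_cmeasurable.
  by move=> x cx; rewrite ger0_norm ?hqB// mulr_ge0 ?sqr_ge0 ?w0.
rewrite sqdistE// lte_fin; apply: le_lt_trans (circint_le ihq iU hqB) _.
rewrite circintD ?circintZ//; do ?exact: itgZ.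
rewrite -/E1 -/W; move: Esum; rewrite ltr_pdivlMr// => Esum.
apply: le_lt_trans Esum; rewrite /K0.
have pW : 0 <= N.+1%:R ^+ 2 * pi * W by rewrite !mulr_ge0// pi_ge0.
have -> : 2 * (N.+1%:R ^+ 2 * (2 * pi * E2)) * W = 4 * (N.+1%:R ^+ 2 * pi * W) * E2 by ring.
have -> : 4 * N.+1%:R ^+ 2 * pi * W = 4 * (N.+1%:R ^+ 2 * pi * W) by ring.
by nra.
Qed.

(** The bound holds only almost everywhere, so [h] is replaced by 0 where it fails; neither Fourier
    coefficients nor weighted distances notice. The weight may vanish on a set of positive
    measure. *)
Lemma bounded_vanishing_L2N N (w : R -> R) h K : itg w ->
  (forall x, circ x -> 0 <= w x) -> vanishes N h ->
  ae_on_circ (fun x => normc (h x) <= K) -> L2N N w h.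
Proof.
move=> iw w0 [ch vh] hK; have mh := citg_cmeasurable ch.
have mw := itg_measurable iw.
have mz : cmeasurable (fun=> 0 : C) by exact: cmeasurable_cst.
split=> //.
  rewrite sqdistE ?ltry//.
  under [fun x => _]funext do rewrite subr0.
  exact: itg_normc2 hK iw.
move=> e e0.
pose b x : R := if normc (h x) <= K then 1 else 0.
pose h' x := (b x)%:C * h x.
have mb : measurable_fun circ b.
  apply: measurable_fun_if => //; try exact: measurable_cst.
  by apply: measurable_fun_ler; [exact: measurable_normc|exact: measurable_cst].
have mh' : cmeasurable h' by apply: cmeasurableM => //; exact: cmeasurable_real.
have hh' : ae_on_circ (fun x => h x = h' x).
  by apply: ae_imp hK => x _ xK; rewrite /h' /b xK mul1r.
have ch' : citg h'.
  apply: citg_le mh' (citg_normc ch) _.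
  by apply: ae_imp hh' => x _ <-.
have vh' : vanishes N h'.
  split=> // k kN; rewrite -(vh k kN); apply: cintegral_ae.
  - by apply: citg_cmeasurable; exact: citgM_expi.
  - by apply: citg_cmeasurable; exact: citgM_expi.
  - by apply: ae_imp hh' => x _ ->.
(* A point where the bound holds shows [0 <= K], which is the bound required where [h'] was set to
   0. *)
have [x0 cx0 K0] := ae_ex hK.
have h'K x : circ x -> normc (h' x) <= K.
  move=> _; rewrite /h' /b; case: ifP => [xK|_]; first by rewrite mul1r.
  by rewrite mul0r normc0 (le_trans (normc_ge0 _) K0).
have [q oq qe] := vanishing_approx iw w0 vh' h'K e0.
exists q => //; rewrite (sqdist_ae mw mh mh' _ hh')//.
by apply: citg_cmeasurable; exact: citg_observed oq.
Qed.

(** When [1 / w] is integrable, Cauchy-Schwarz bounds the L_1 norm by the L_2(w) norm, so Fourier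
    coefficients are continuous on L_2(w); those at 0, ..., N vanish on the observed span. *)
Lemma L2N_vanishes N (w : R -> R) h : measurable_fun circ w ->
  (forall x, circ x -> 0 <= w x) ->
  ae_on_circ (fun x => 0 < w x) -> itg (fun x => (w x)^-1) ->
  L2N N w h ->
  itg (fun x => normc (h x) ^+ 2 * w x) /\ vanishes N h.
Proof.
move=> mw w0 wp iw [mh hfin happ].
have itg2 p : cmeasurable p -> (sqdist w h p < +oo)%E ->
    itg (fun x => normc (h x - p x) ^+ 2 * w x).
  move=> mp fp; apply/integrableP; split.
    exact: (measurable_EFin (measurable_sqdist mw mh mp)).
  apply: le_lt_trans fp; rewrite le_eqVlt; apply/orP; left; apply/eqP.
  apply: eq_integral => x /set_mem cx.
  by rewrite /= ger0_norm// mulr_ge0 ?sqr_ge0 ?w0.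
have itgn p : cmeasurable p -> itg (fun x => normc (p x) ^+ 2 * w x) -> citg p.
  move=> mp ip; apply: (@citg_le _ _ (fun x => normc (p x) ^+ 2 * w x + (w x)^-1)) => //.
    exact: itgD.
  apply: ae_imp wp => x _ wp.
  rewrite -subr_ge0; have := normc_ge0 (p x); set n := normc _ => n0.
  have -> : n ^+ 2 * w x + (w x)^-1 - n =
      ((n * w x - 2^-1) ^+ 2 + 3 / 4) / w x by field; rewrite gt_eqF.
  by apply: divr_ge0; [apply: addr_ge0; [exact: sqr_ge0|lra]|exact: ltW].
have ih2 : itg (fun x => normc (h x) ^+ 2 * w x).
  have := itg2 _ (cmeasurable_cst 0) hfin.
  by under [fun x => _]funext do rewrite subr0.
have ch := itgn _ mh ih2.
split=> //; split=> // k kN.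
apply: eq0_normc; apply/eqP; rewrite eq_le normc_ge0 andbT.
pose W := circint (fun x => (w x)^-1).
have W0 : 0 <= W by apply: circint_ge0 => x cx; rewrite invr_ge0 w0.
apply/ler_addgt0Pl => e e0; rewrite addr0.
(* This makes [m * W <= e / 2]. An approximation with error [E1 < m * (e / 2)] then turns
   [2 * m * F <= E1 + m ^+ 2 * W] into [2 * F <= e]. *)
pose m := e / 2 / (W + 1).
have m0 : 0 < m by rewrite !divr_gt0// ltr_wpDl.
have mW : m * W <= e / 2.
  rewrite /m mulrAC ler_pdivrMr ?ltr_wpDl//; nra.
have [p op pe] := happ (m * (e / 2)) ltac:(by rewrite mulr_gt0//; lra).
have cp := citg_observed op; have mp := citg_cmeasurable cp.
have ihp := itg2 p mp (lt_trans pe (ltry _)).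
have cd : citg (fun x => h x - p x) by exact: citgB.
have -> : fourier h k = fourier (fun x => h x - p x) k.
  by rewrite fourierB// (fourier_observed op kN) subr0.
apply: le_trans (normc_fourier _ cd) _.
rewrite sqdistE// lte_fin in pe.
have := cauchy_schwarz_param m (citg_normc cd) ihp iw wp.
rewrite -/W; set F := circint _; set E1 := circint _ in pe * => cs.
have : 2 * m * F <= m * e by rewrite expr2 in cs; nra.
by rewrite -mulrA mulrCA ler_pM2l.
Qed.

End WeightedSpan.

(** * Toeplitz forms and the minimal error *)

Section Interpolation.
Context {R : realType}.
Local Notation mu := (@lebesgue_measure R).
Local Notation circ := (@circ R).
Local Notation C := R[i].
Local Notation Re := (@complex.Re R).
Local Notation Im := (@complex.Im R).
Variable N : nat.
Implicit Types (h : R -> C) (f g psi : R -> R) (a c : 'cV[C]_N.+1).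

Lemma itg_ae_eq (u v : R -> R) : measurable_fun circ u -> itg v ->
  ae_on_circ (fun x => u x = v x) -> itg u.
Proof.
move=> mu1 iv uv; apply: (itg_le_ae mu1 (integrable_norm iv)).
by apply: ae_imp uv => x _ ->.
Qed.

Lemma trig_poly_bounded a : exists K, forall x, normc (trig_poly a x) <= K.
Proof. by exists (\sum_(k < N.+1) normc (a k 0)) => x; exact: normc_trig_poly. Qed.

Lemma cmeasurable_trig_poly a : cmeasurable (trig_poly a).
Proof. by apply: citg_cmeasurable; exact: citg_trig_poly. Qed.

Lemma citg_trig_polyM a psi : itg psi -> citg (fun x => trig_poly a x * (psi x)%:C).
Proof.
move=> ipsi; have [K aK] := trig_poly_bounded a.
apply: (@citg_le _ _ (fun x => K * `|psi x|)).
- apply: cmeasurableM; first exact: cmeasurable_trig_poly.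
  by apply: cmeasurable_real; exact: itg_measurable.
- by apply: itgZ; exact: integrable_norm.
apply: ae_true => x _; by rewrite normcM normc_real ler_wpM2r.
Qed.

Lemma inner_fourier h c : citg h ->
  \sum_(k < N.+1) fourier h k * (c k 0)^* = cintegral (fun x => h x * (trig_poly c x)^*).
Proof.
move=> ch.
have -> : (fun x => h x * (trig_poly c x)^*) =
    (fun x => \sum_(k < N.+1) (c k 0)^* * (h x * expi (- k%:R * x))).
  apply/funext => x; rewrite /trig_poly rmorph_sum mulr_sumr; apply: eq_bigr => k _.
  by rewrite rmorphM/= conjc_expi mulNr; ring.
rewrite cintegral_sum => [|k]; last by apply: citgZ; exact: citgM_expi.
apply: eq_bigr => k _; rewrite cintegralZ; last exact: citgM_expi.
by rewrite mulrC.
Qed.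

Lemma vanishes_orthogonal h c : vanishes N h ->
  cintegral (fun x => h x * (trig_poly c x)^*) = 0.
Proof.
move=> [ch vh]; rewrite -inner_fourier//; apply: big1 => k _.
by rewrite vh ?mul0r// -ltnS ltn_ord.
Qed.

(** The Toeplitz matrix is multiplication by its symbol compressed to the frequencies 0, ..., N.
    Matrix equations thereby become equalities of Fourier coefficients. *)
Lemma toeplitz_mulE psi a (k : 'I_N.+1) : itg psi ->
  (toeplitz N psi *m a) k 0 =
  ((2 * pi)^-1)%:C * fourier (fun x => trig_poly a x * (psi x)%:C) k.
Proof.
move=> ipsi; rewrite mxE.
have -> : fourier (fun x => trig_poly a x * (psi x)%:C) k =
    \sum_(j < N.+1) a j 0 * cintegral (fun x => (psi x)%:C * expi (- (k%:R - j%:R) * x)).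
  have cpsi : citg (fun x => (psi x)%:C) by split => //; exact: itg_cst.
  rewrite -[RHS]/(\sum_(j < N.+1) _).
  transitivity (cintegral (fun x => \sum_(j < N.+1)
      a j 0 * ((psi x)%:C * expi (- (k%:R - j%:R) * x)))).
    congr cintegral; apply/funext => x; rewrite /trig_poly !mulr_suml.
    apply: eq_bigr => j _; rewrite opprB mulrBl expiD mulNr; ring.
  rewrite cintegral_sum => [|j]; last by apply: citgZ; exact: citgM_expi.
  by apply: eq_bigr => j _; rewrite cintegralZ//; exact: citgM_expi.
rewrite mulr_sumr; apply: eq_bigr => j _; rewrite mxE -mulrA; congr (_ * _).
rewrite mulrC; congr (_ * _); congr cintegral; apply/funext => x.
by rewrite mulNr mulrC.
Qed.

Lemma inner_toeplitz psi a : itg psi ->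
  inner (toeplitz N psi *m a) a =
  ((2 * pi)^-1 * circint (fun x => normc (trig_poly a x) ^+ 2 * psi x))%:C.
Proof.
move=> ipsi; rewrite /inner.
under eq_bigr do rewrite toeplitz_mulE// -mulrA.
rewrite -mulr_sumr inner_fourier; last exact: citg_trig_polyM.
rewrite rmorphM; congr (_ * _); rewrite cintegralE; apply: complex_ext => /=.
  by apply: circint_eq => x _; rewrite sqr_normcE !ReImE/=; ring.
rewrite -[RHS](mul0r (2 * pi)) -circint_cst.
by apply: circint_eq => x _; rewrite !ReImE/=; ring.
Qed.

Lemma normc_sqr_eq0 (z : C) : normc z ^+ 2 = 0 -> z = 0.
Proof. by move=> /eqP; rewrite expf_eq0/= => /eqP; exact: eq0_normc. Qed.

(** The quadratic form vanishes at a kernel vector, so its polynomial is zero almost everywhere, and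
    so are the coefficients recovered from it. *)
Lemma toeplitz_unit psi : itg psi -> (forall x, circ x -> 0 <= psi x) ->
  ae_on_circ (fun x => 0 < psi x) -> toeplitz N psi \in unitmx.
Proof.
move=> ipsi psi0 psip; rewrite -unitmx_tr -row_free_unit.
apply: inj_row_free => v /(congr1 trmx); rewrite trmx_mul trmxK trmx0.
set c := v^T => Tc.
suff c0 : c = 0 by rewrite -[v]trmxK -/c c0 trmx0.
have [K cK] := trig_poly_bounded c.
have : inner (toeplitz N psi *m c) c = 0.
  by rewrite Tc /inner big1// => k _; rewrite mxE mul0r.
rewrite inner_toeplitz// => -[/eqP].
rewrite mulf_eq0 invr_eq0 mulf_eq0 pnatr_eq0 /= gt_eqF ?pi_gt0//= => /eqP I0.
have ic : itg (fun x => normc (trig_poly c x) ^+ 2 * psi x).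
  apply: (@itg_normc2 _ _ _ K) => //; first exact: cmeasurable_trig_poly.
  exact: ae_true.
have c0 : ae_on_circ (fun x => trig_poly c x = 0).
  have h0 x : circ x -> 0 <= normc (trig_poly c x) ^+ 2 * psi x.
    by move=> cx; rewrite mulr_ge0 ?sqr_ge0 ?psi0.
  have := circint_ge0_eq0 ic h0; rewrite I0 lexx => /(_ isT) Z.
  apply: ae_imp (ae_and Z psip) => x _ [/eqP + px].
  by rewrite mulf_eq0 (gt_eqF px) orbF => /eqP; exact: normc_sqr_eq0.
apply/colP => k; rewrite [RHS]mxE.
have : fourier (trig_poly c) k = 0.
  rewrite /fourier (@cintegral_ae _ _ (fun=> 0)).
  - by rewrite cintegralE/= circint_cst mul0r.
  - by apply: citg_cmeasurable; apply: citgM_expi; exact: citg_trig_poly.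
  - exact: cmeasurable_cst.
  - by apply: ae_imp c0 => x _ ->; rewrite mul0r.
rewrite fourier_trig_poly => /eqP; rewrite mulf_eq0 => /orP[|/eqP//].
rewrite -[0]/((0 : R)%:C) (inj_eq (@complexI R)) mulf_eq0 pnatr_eq0/=.
by rewrite gt_eqF// pi_gt0.
Qed.


Lemma Re_divr (z : C) (r : R) : Re (z / r%:C) = Re z / r.
Proof. by rewrite -fmorphV/= !ReImE/=; ring. Qed.

Lemma Im_divr (z : C) (r : R) : Im (z / r%:C) = Im z / r.
Proof. by rewrite -fmorphV/= !ReImE/=; ring. Qed.

Definition optimal a f g x : C := num_g a f g x / (f x + g x)%:C.

Definition error_density a h f g x : R :=
  normc (trig_poly a x - h x) ^+ 2 * f x + normc (h x) ^+ 2 * g x.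

Lemma mean_EFin f : itg f -> mean (EFin \o f) = ((2 * pi)^-1 * circint f)%:E.
Proof. by move=> itf; rewrite /mean EFinM EFin_circint. Qed.

Lemma power_class_itg P f : power_class P f -> itg f /\ (2 * pi)^-1 * circint f <= P.
Proof.
by move=> [[_ _ itf]]; rewrite mean_EFin// lee_fin => fP; split.
Qed.

Lemma Delta_error_density a h f g : (forall x, circ x -> 0 <= f x) ->
  (forall x, circ x -> 0 <= g x) -> cmeasurable h ->
  measurable_fun circ f -> measurable_fun circ g ->
  itg (error_density a h f g) ->
  Delta a h f g = ((2 * pi)^-1 * circint (error_density a h f g))%:E.
Proof.
move=> f0 g0 mh mf mg iE.
have mA := cmeasurable_trig_poly a.
have pos1 x : circ x -> 0 <= normc (trig_poly a x - h x) ^+ 2 * f x.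
  by move=> cx; rewrite mulr_ge0 ?sqr_ge0 ?f0.
have pos2 x : circ x -> 0 <= normc (h x) ^+ 2 * g x.
  by move=> cx; rewrite mulr_ge0 ?sqr_ge0 ?g0.
have m2 : measurable_fun circ (fun x => normc (h x) ^+ 2 * g x).
  by apply: measurable_funM => //; apply: measurable_funX; exact: measurable_normc.
have i1 : itg (fun x => normc (trig_poly a x - h x) ^+ 2 * f x).
  apply: itg_le iE _; first exact: measurable_sqdist.
  by move=> x cx; rewrite ger0_norm ?pos1// lerDl pos2.
have i2 : itg (fun x => normc (h x) ^+ 2 * g x).
  apply: itg_le iE _ => // x cx.
  by rewrite ger0_norm ?pos2// lerDr pos1.
rewrite /Delta -[X in (X + _)%E]/(mean (EFin \o (fun x => _))) mean_EFin//.
rewrite -[X in (_ + X)%E]/(mean (EFin \o (fun x => _))) mean_EFin//.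
by rewrite -EFinD -mulrDr -circintD.
Qed.

(** * Minimal error for a fixed pair of densities *)

Section Densities.
Variables (a : 'cV[C]_N.+1) (f g : R -> R).
Hypotheses (f_itg : itg f) (g_itg : itg g).
Hypothesis f_ge0 : forall x, circ x -> 0 <= f x.
Hypothesis g_ge0 : forall x, circ x -> 0 <= g x.
Local Notation w := (fun x => f x + g x).

Let w_ge0 x : circ x -> 0 <= w x.
Proof. by move=> cx; rewrite addr_ge0 ?f_ge0 ?g_ge0. Qed.

Let mw : measurable_fun circ w.
Proof. by apply: measurable_funD; exact: itg_measurable. Qed.

Lemma itg_num_over_den : itg (fun x => f x / w x).
Proof.
apply: itg_le (@itg_cst _ 1) _.
  apply: measurable_funM; first exact: itg_measurable.
  exact: measurable_inv_ge0.
move=> x cx; rewrite ger0_norm ?divr_ge0 ?f_ge0 ?w_ge0//.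
have [->|wn0] := eqVneq (w x) 0; first by rewrite invr0 mulr0.
by rewrite ler_pdivrMr ?lt_neqAle 1?eq_sym ?wn0 ?w_ge0// mul1r lerDl g_ge0.
Qed.

Lemma itg_parallel : itg (fun x => f x * g x / w x).
Proof.
have -> : (fun x => f x * g x / w x) = (fun x => f x / w x * g x).
  by apply/funext => x; rewrite mulrAC.
apply: (itg_bndM (K := 1) (itg_measurable itg_num_over_den) _ g_itg) => x cx.
rewrite ger0_norm ?divr_ge0 ?f_ge0 ?w_ge0//.
have [->|wn0] := eqVneq (w x) 0; first by rewrite invr0 mulr0.
by rewrite ler_pdivrMr ?lt_neqAle 1?eq_sym ?wn0 ?w_ge0// mul1r lerDl g_ge0.
Qed.

Let inv_w x : (((f x + g x)%:E)^-1)%E =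
  if f x + g x == 0 then +oo%E else ((f x + g x)^-1)%:E.
Proof. by rewrite inver. Qed.

Let measurable_inv_w : measurable_fun circ (fun x => (((f x + g x)%:E)^-1)%E).
Proof.
apply: (@eq_measurable_fun _ _ _ _ _
    (fun x => if f x + g x == 0 then +oo%E else ((f x + g x)^-1)%:E)).
  by move=> x _; rewrite inv_w.
apply: measurable_fun_if => //.
  by apply: measurable_fun_eqr => //; exact: measurable_cst.
apply: (@measurable_funS _ _ _ _ circ) => //.
exact: measurable_EFin (measurable_inv_ge0 mw w_ge0).
Qed.

(** An integrable function is finite almost everywhere, and the extended inverse is [+oo] at zeros
    of [f + g]; so these form a null set, off which the extended and the real inverse agree. *)
Lemma minimal_inv : minimal f g ->
  ae_on_circ (fun x => 0 < f x + g x) /\ itg (fun x => (f x + g x)^-1).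
Proof.
move=> min.
have inv_ge0 x : circ x -> (0 <= ((f x + g x)%:E)^-1)%E.
  move=> cx; rewrite inv_w; case: eqP => // _; rewrite ?leey// lee_fin invr_ge0.
  exact: w_ge0.
have I : mu.-integrable circ (fun x => ((f x + g x)%:E)^-1%E).
  apply/integrableP; split=> //; apply: le_lt_trans min.
  rewrite le_eqVlt; apply/orP; left; apply/eqP; apply: eq_integral => x /set_mem cx.
  by rewrite gee0_abs ?inv_ge0.
split.
  have := @integrable_ae _ _ _ mu circ measurable_circ _ I; apply: ae_imp => x cx.
  rewrite inv_w; case: eqP => // /eqP wn0 _.
  by rewrite lt_neqAle eq_sym wn0 w_ge0.
apply: (@le_integrable _ _ _ mu circ measurable_circ _ _ _ _ I) => //.
  exact: measurable_EFin (measurable_inv_ge0 mw w_ge0).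
move=> x cx; rewrite inv_w /=; case: eqP => [->|//].
by rewrite invr0 normr0 leey.
Qed.

Lemma minimal_lower_bound d : 0 < d -> (forall x, circ x -> d <= f x + g x) ->
  minimal f g.
Proof.
move=> d0 dw.
have I : itg (fun x => (f x + g x)^-1).
  apply: itg_le (@itg_cst _ d^-1) _; first exact: measurable_inv_ge0.
  move=> x cx; have wd := dw x cx.
  by rewrite ger0_norm ?invr_ge0 ?w_ge0// lef_pV2 ?posrE// (lt_le_trans d0).
rewrite /minimal (_ : (\int[mu]_(x in circ) _)%E = (circint (fun x => (f x + g x)^-1))%:E).
  exact: ltry.
rewrite EFin_circint//; apply: eq_integral => x /set_mem cx.
by rewrite inv_w gt_eqF// (lt_le_trans d0) ?dw.
Qed.

Section Minimal.
Hypothesis f_g_minimal : minimal f g.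

Let w_gt0 : ae_on_circ (fun x => 0 < w x).
Proof. by have [] := minimal_inv f_g_minimal. Qed.

Let inv_itg : itg (fun x => (w x)^-1).
Proof. by have [] := minimal_inv f_g_minimal. Qed.

Lemma Bmx_unit : Bmx N f g \in unitmx.
Proof.
apply: toeplitz_unit => //.
  by move=> x cx; rewrite invr_ge0 w_ge0.
by apply: ae_imp w_gt0 => x _ wp; rewrite invr_gt0.
Qed.

Lemma optimalE x : optimal a f g x =
  trig_poly a x * (f x / w x)%:C - trig_poly (Ccoef a f g) x * ((w x)^-1)%:C.
Proof. by rewrite /optimal /num_g mulrBl -fmorphV rmorphM/= mulrA. Qed.

Lemma optimal_vanishes : vanishes N (optimal a f g).
Proof.
have c1 := citg_trig_polyM a itg_num_over_den.
have c2 := citg_trig_polyM (Ccoef a f g) inv_itg.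
rewrite (funext optimalE); split; first exact: citgB.
move=> k kN; rewrite fourierB//.
have kN' : (k < N.+1)%N by rewrite ltnS.
have : (Rmx N f g *m a) (Ordinal kN') 0 =
       (Bmx N f g *m Ccoef a f g) (Ordinal kN') 0.
  by rewrite /Ccoef -mulmxA mulKVmx// Bmx_unit.
rewrite !toeplitz_mulE//; last exact: itg_num_over_den.
have p0 : ((2 * pi)^-1)%:C != 0 :> C.
  rewrite -[0]/((0 : R)%:C) (inj_eq (@complexI R)) invr_eq0 mulf_eq0 pnatr_eq0/=.
  by rewrite gt_eqF// pi_gt0.
by move=> /(mulfI p0) ->; rewrite subrr.
Qed.

Let cm_optimal : cmeasurable (optimal a f g).
Proof. by apply: citg_cmeasurable; case: optimal_vanishes. Qed.

(** With A and C the polynomials of [a] and [Ccoef], the two errors are |A g + C|^2 f / w^2 and |A f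
    - C|^2 g / w^2; their cross terms cancel. What remains are the integrands of the forms of [Qmx]
    at [a] and of [Bmx] at [Ccoef]. *)
Lemma error_density_optimal x : 0 < w x ->
  error_density a (optimal a f g) f g x =
  normc (trig_poly a x) ^+ 2 * (f x * g x / w x) +
  normc (trig_poly (Ccoef a f g) x) ^+ 2 * (w x)^-1.
Proof.
move=> wp; rewrite /error_density /optimal /num_g !sqr_normcE.
rewrite !(Re_divr, Im_divr, ReImE)/=.
by field; rewrite gt_eqF.
Qed.

(** Expansion around the optimal characteristic. The factor of the linear term is [optimal * w]
    minus A f, which is minus the polynomial of [Ccoef]: it involves the frequencies 0, ..., N
    only. *)
Lemma error_density_diff h x : 0 < w x ->
  error_density a h f g x = error_density a (optimal a f g) f g x +
    normc (h x - optimal a f g x) ^+ 2 * w x -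
    2 * Re ((h x - optimal a f g x) * (trig_poly (Ccoef a f g) x)^*).
Proof.
move=> wp; rewrite /error_density /optimal /num_g !sqr_normcE.
rewrite !(Re_divr, Im_divr, ReImE)/=.
by field; rewrite gt_eqF.
Qed.

Lemma measurable_error_density h : cmeasurable h ->
  measurable_fun circ (error_density a h f g).
Proof.
move=> mh; apply: measurable_funD.
  apply: measurable_sqdist => //; first exact: itg_measurable.
  exact: cmeasurable_trig_poly.
apply: measurable_funM; last exact: itg_measurable.
by apply: measurable_funX; exact: measurable_normc.
Qed.

Let itg_forms :
  itg (fun x => normc (trig_poly a x) ^+ 2 * (f x * g x / w x)) /\
  itg (fun x => normc (trig_poly (Ccoef a f g) x) ^+ 2 * (w x)^-1).
Proof.
have [K aK] := trig_poly_bounded a.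
have [L cL] := trig_poly_bounded (Ccoef a f g).
split.
  apply: (@itg_normc2 _ _ _ K); [exact: cmeasurable_trig_poly|exact: ae_true|].
  exact: itg_parallel.
by apply: (@itg_normc2 _ _ _ L); [exact: cmeasurable_trig_poly|exact: ae_true|].
Qed.

Lemma itg_error_optimal : itg (error_density a (optimal a f g) f g).
Proof.
have [i1 i2] := itg_forms.
apply: itg_ae_eq (itgD i1 i2) _; first exact: measurable_error_density.
by apply: ae_imp w_gt0 => x _; exact: error_density_optimal.
Qed.

(** Since R a = B C, the first term of the objective is the form of B at C, and
    [error_density_optimal] identifies both terms. *)
Lemma objective_error : objective a f g =
  ((2 * pi)^-1 * circint (error_density a (optimal a f g) f g))%:C.
Proof.
have [i1 i2] := itg_forms.
rewrite (@circint_ae _ _ (fun x => normc (trig_poly a x) ^+ 2 * (f x * g x / w x) +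
  normc (trig_poly (Ccoef a f g) x) ^+ 2 * (w x)^-1)).
- rewrite circintD// mulrDr rmorphD/= addrC /objective; congr (_ + _).
    have RB : Rmx N f g *m a = Bmx N f g *m Ccoef a f g.
      by rewrite /Ccoef -mulmxA mulKVmx// Bmx_unit.
    have -> : invmx (Bmx N f g) *m (Rmx N f g *m a) = Ccoef a f g.
      by rewrite /Ccoef mulmxA.
    by rewrite RB inner_toeplitz.
  by rewrite inner_toeplitz//; exact: itg_parallel.
- exact: measurable_error_density.
- by apply: itg_measurable; exact: itgD.
- by apply: ae_imp w_gt0 => x _; exact: error_density_optimal.
Qed.

(** The Pythagoras identity: the linear term of [error_density_diff] integrates to 0 because
    [h - optimal] has vanishing coefficients. Integrability of the squared distance is itself
    deduced from the pointwise identity. *)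
Lemma circint_error_density h : vanishes N h -> itg (error_density a h f g) ->
  itg (fun x => normc (h x - optimal a f g x) ^+ 2 * w x) /\
  circint (error_density a h f g) =
    circint (error_density a (optimal a f g) f g) +
    circint (fun x => normc (h x - optimal a f g x) ^+ 2 * w x).
Proof.
move=> vh iE; have iO := itg_error_optimal.
have [ch _] := vh; have [co vo] := optimal_vanishes.
have vd : vanishes N (fun x => h x - optimal a f g x).
  split; first exact: citgB.
  by move=> k kN; rewrite fourierB// vo// subr0; case: vh => _ ->.
have [cd _] := vd.
pose c := Ccoef a f g.
pose X x := (h x - optimal a f g x) * (trig_poly c x)^*.
have [L cL] := trig_poly_bounded c.
have mX : cmeasurable X.
  have [m1 m2] := cmeasurable_trig_poly c.
  apply: cmeasurableM; first exact: citg_cmeasurable.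
  split; first by under [fun x => _]funext do rewrite ReJ.
  by under [fun x => _]funext do rewrite ImJ; exact: measurable_funN.
have cX : citg X.
  apply: citg_le mX (itgZ L (citg_normc cd)) _; apply: ae_true => x _.
  rewrite /X normcM mulrC ler_wpM2r ?normc_ge0//.
  by case: (trig_poly c x) (cL x) => u v; rewrite /normc /= sqrrN.
have [rX _] := cX.
have X0 : circint (fun x => Re (X x)) = 0.
  by have := vanishes_orthogonal c vd; rewrite cintegralE => -[].
have mD : measurable_fun circ (fun x => normc (h x - optimal a f g x) ^+ 2 * w x).
  by apply: measurable_sqdist => //; exact: citg_cmeasurable.
have iD : itg (fun x => normc (h x - optimal a f g x) ^+ 2 * w x).
  apply: (@itg_ae_eq _ (fun x => error_density a h f g x -
      error_density a (optimal a f g) f g x + 2 * Re (X x))) => //.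
    by apply: itgD; [exact: itgB|exact: itgZ].
  by apply: ae_imp w_gt0 => x _ wp; rewrite (error_density_diff h wp) -/c /X; ring.
split=> //; rewrite -circintD//.
rewrite -[RHS]subr0 -[X in _ = _ - X](mulr0 2) -X0 -circintZ// -circintB//; last 2 first.
- exact: itgD.
- exact: itgZ.
apply: circint_ae.
- exact: itg_measurable.
- by apply: itg_measurable; apply: itgB; [exact: itgD|exact: itgZ].
- by apply: ae_imp w_gt0 => x _ wp; rewrite (error_density_diff h wp).
Qed.

(** The bound gives membership in [L2N]. Competitors in [L2N] have vanishing coefficients and finite
    error, so Pythagoras gives minimality. *)
Lemma optimal_charP K : ae_on_circ (fun x => normc (optimal a f g x) <= K) ->
  optimal_char a f g (optimal a f g).
Proof.
move=> oK; split.
  apply: (@bounded_vanishing_L2N _ _ _ _ K) => //; first exact: itgD.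
  exact: optimal_vanishes.
move=> h hL; have [mh _ _] := hL.
have [ih2 vh] := L2N_vanishes mw w_ge0 w_gt0 inv_itg hL.
have [L aL] := trig_poly_bounded a.
have iE : itg (error_density a h f g).
  have iA : itg (fun x => normc (trig_poly a x) ^+ 2 * w x).
    apply: (@itg_normc2 _ _ _ L); [exact: cmeasurable_trig_poly|exact: ae_true|].
    exact: itgD.
  (* 2 and 3 arise from |A - h|^2 <= 2 |A|^2 + 2 |h|^2, together with the further |h|^2 of the
     second error term. *)
  apply: (itg_le _ (itgD (itgZ 2 iA) (itgZ 3 ih2))).
    exact: measurable_error_density.
  move=> x cx; have fx := f_ge0 cx; have gx := g_ge0 cx.
  rewrite ger0_norm; last by rewrite addr_ge0// mulr_ge0// sqr_ge0.
  have := normcD_sqr (trig_poly a x) (- h x); rewrite normcN /error_density.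
  have := sqr_ge0 (normc (h x)); have := sqr_ge0 (normc (trig_poly a x)).
  set A := _ ^+ 2; set H := normc (h x) ^+ 2; set B := _ ^+ 2 => A0 H0 BAH.
  have : B * f x <= (2 * A + 2 * H) * f x by exact: ler_wpM2r.
  by have := mulr_ge0 A0 gx; have := mulr_ge0 H0 gx; have := mulr_ge0 H0 fx; nra.
have mf := itg_measurable f_itg; have mg := itg_measurable g_itg.
rewrite !Delta_error_density//; last exact: itg_error_optimal.
rewrite lee_fin ler_pM2l ?invr_gt0 ?mulr_gt0 ?pi_gt0//.
have [_ ->] := circint_error_density vh iE.
rewrite lerDl; apply: circint_ge0 => x cx.
by rewrite mulr_ge0 ?sqr_ge0 ?w_ge0.
Qed.

End Minimal.
End Densities.

End Interpolation.

(** * The saddle point *)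

Section SaddlePoint.
Context {R : realType}.
Local Notation mu := (@lebesgue_measure R).
Local Notation circ := (@circ R).
Local Notation C := R[i].
Variables (N : nat) (a : 'cV[C]_N.+1) (f0 g0 : R -> R).

Lemma normc_optimal alpha x : 0 < f0 x + g0 x ->
  normc (num_g a f0 g0 x) = alpha * (f0 x + g0 x) ->
  normc (optimal a f0 g0 x) = alpha.
Proof.
move=> wp e; rewrite /optimal normcM e normcV normc_real gtr0_norm// mulfK//.
by rewrite gt_eqF.
Qed.

Lemma normc_optimal_residual alpha x : 0 < f0 x + g0 x ->
  normc (num_f a f0 g0 x) = alpha * (f0 x + g0 x) ->
  normc (trig_poly a x - optimal a f0 g0 x) = alpha.
Proof.
move=> wp e.
have -> : trig_poly a x - optimal a f0 g0 x = num_f a f0 g0 x / (f0 x + g0 x)%:C.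
  rewrite /optimal /num_f /num_g; apply: complex_ext;
    rewrite !(Re_divr, Im_divr, ReImE)/=; field; exact/lt0r_neq0.
rewrite normcM e normcV normc_real gtr0_norm// mulfK//.
by rewrite gt_eqF.
Qed.

(* Perturb the densities by constants: as the value of the estimation problem
   is an infimum of functionals increasing in [f] and [g], it can only fail to
   increase if the optimal characteristic ignores the perturbed density. *)
Lemma slack_null (c1 c2 : R) : itg f0 -> itg g0 ->
  (forall x, circ x -> 0 <= f0 x) -> (forall x, circ x -> 0 <= g0 x) ->
  minimal f0 g0 -> 0 <= c1 -> 0 <= c2 -> 0 < c1 + c2 ->
  let f1 := fun x => f0 x + c1 in let g1 := fun x => g0 x + c2 in
  (minimal f1 g1 -> objective a f1 g1 <= objective a f0 g0) ->
  ae_on_circ (fun x =>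
    c1 * normc (trig_poly a x - optimal a f0 g0 x) ^+ 2 = 0 /\
    c2 * normc (optimal a f0 g0 x) ^+ 2 = 0).
Proof.
move=> if0 ig0 f00 g00 min0 c10 c20 c120 f1 g1.
have if1 : itg f1 by apply: itgD => //; exact: itg_cst.
have ig1 : itg g1 by apply: itgD => //; exact: itg_cst.
have f10 x : circ x -> 0 <= f1 x by move=> cx; rewrite addr_ge0 ?f00.
have g10 x : circ x -> 0 <= g1 x by move=> cx; rewrite addr_ge0 ?g00.
have min1 : minimal f1 g1.
  apply: (minimal_lower_bound if1 ig1 f10 g10 c120) => x cx.
  by have := f00 x cx; have := g00 x cx; rewrite /f1 /g1; lra.
move=> /(_ min1); rewrite !objective_error// lecR.
rewrite ler_pM2l ?invr_gt0 ?mulr_gt0 ?pi_gt0//.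
set h0 := optimal a f0 g0; set h1 := optimal a f1 g1.
have vh1 : vanishes N h1 by exact: optimal_vanishes.
have [ch1 _] := vh1; have mh1 := citg_cmeasurable ch1.
have iE1 : itg (error_density a h1 f1 g1) by exact: itg_error_optimal.
(* The part of the error of [h1] that is due to the added constants. *)
pose S x := c1 * normc (trig_poly a x - h1 x) ^+ 2 + c2 * normc (h1 x) ^+ 2.
have S0 x : 0 <= S x by rewrite addr_ge0// mulr_ge0// sqr_ge0.
have E1E : error_density a h1 f1 g1 = (fun x => error_density a h1 f0 g0 x + S x).
  by apply/funext => x; rewrite /error_density /S /f1 /g1; ring.
have E0 x : circ x -> 0 <= error_density a h1 f0 g0 x.
  by move=> cx; rewrite addr_ge0// mulr_ge0 ?sqr_ge0 ?f00 ?g00.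
have iE10 : itg (error_density a h1 f0 g0).
  apply: itg_le iE1 _; first exact: measurable_error_density.
  by move=> x cx; rewrite E1E ger0_norm ?E0// lerDl.
have iS : itg S.
  have -> : S = (fun x => error_density a h1 f1 g1 x - error_density a h1 f0 g0 x).
    by apply/funext => x; rewrite E1E; ring.
  exact: itgB.
have [iD ED] := circint_error_density if0 ig0 f00 g00 min0 vh1 iE10.
rewrite E1E circintD// ED -addrA gerDl -circintD// => le0.
have D0 x : circ x -> 0 <= normc (h1 x - h0 x) ^+ 2 * (f0 x + g0 x).
  by move=> cx; rewrite mulr_ge0 ?sqr_ge0// addr_ge0 ?f00 ?g00.
have DS0 x : circ x -> 0 <= normc (h1 x - h0 x) ^+ 2 * (f0 x + g0 x) + S x.
  by move=> cx; rewrite addr_ge0 ?D0.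
have DSz := circint_ge0_eq0 (itgD iD iS) DS0 le0.
have [wp _] := minimal_inv if0 ig0 f00 g00 min0.
apply: ae_imp (ae_and DSz wp) => x cx [/eqP].
rewrite paddr_eq0 ?D0// => /andP[/eqP D /eqP S00] wx.
have h10 : h1 x = h0 x.
  move: D => /eqP; rewrite mulf_eq0 (gt_eqF wx) orbF => /eqP /normc_sqr_eq0/eqP.
  by rewrite subr_eq0 => /eqP.
move: S00 => /eqP; rewrite /S h10 paddr_eq0; try by rewrite mulr_ge0// sqr_ge0.
by move=> /andP[/eqP -> /eqP ->].
Qed.

End SaddlePoint.

Theorem theorem7p2 (R : realType) (N : nat) (a : 'cV[R[i]]_N.+1) (P1 P2 : R)
    (f0 g0 : R -> R) (alpha1 alpha2 : R)
    (P1_gt0 : 0 < P1) (P2_gt0 : 0 < P2)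
    (f0_class : power_class P1 f0) (g0_class : power_class P2 g0)
    (f0g0_minimal : minimal f0 g0)
    (hf_bounded : ess_bounded (h_f a f0 g0))
    (hg_bounded : ess_bounded (h_g a f0 g0))
    (alpha1_ge0 : 0 <= alpha1) (alpha2_ge0 : 0 <= alpha2)
    (f_eq : ae_on_circ
       (fun x => normc (num_f a f0 g0 x) = alpha1 * (f0 x + g0 x)))
    (g_eq : ae_on_circ
       (fun x => normc (num_g a f0 g0 x) = alpha2 * (f0 x + g0 x)))
    (f0g0_max : forall f g : R -> R, power_class P1 f -> power_class P2 g ->
       minimal f g -> objective a f g <= objective a f0 g0) :
  let D := power_class P1 `*` power_class P2 in
  least_favourable a D f0 g0 /\
  minimax_robust a D (fun x => num_g a f0 g0 x / (f0 x + g0 x)%:C).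
Proof.
move=> D.
have [[mf0 f00 _] _] := f0_class; have [[mg0 g00 _] _] := g0_class.
have [if0 f0P] := power_class_itg f0_class.
have [ig0 g0P] := power_class_itg g0_class.
have mean_gt0 : 0 < (2 * pi)^-1 :> R by rewrite invr_gt0 mulr_gt0// pi_gt0.
have [wp _] := minimal_inv if0 ig0 f00 g00 f0g0_minimal.
pose h0 := optimal a f0 g0.
have h0a2 : ae_on_circ (fun x => normc (h0 x) = alpha2).
  by apply: ae_imp (ae_and wp g_eq) => x _ [px]; exact: normc_optimal.
have Ah0a1 : ae_on_circ (fun x => normc (trig_poly a x - h0 x) = alpha1).
  by apply: ae_imp (ae_and wp f_eq) => x _ [px]; exact: normc_optimal_residual.
have h0B : ae_on_circ (fun x => normc (h0 x) <= alpha2).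
  by apply: ae_imp h0a2 => x _ ->.
have vh0 : vanishes N h0 by exact: optimal_vanishes.
have [ch0 _] := vh0; have mh0 := citg_cmeasurable ch0.
have DeltaE f g : itg f -> itg g -> (forall x, circ x -> 0 <= f x) ->
    (forall x, circ x -> 0 <= g x) ->
    Delta a h0 f g = (alpha1 ^+ 2 * ((2 * pi)^-1 * circint f) +
                      alpha2 ^+ 2 * ((2 * pi)^-1 * circint g))%:E.
  move=> itf itg' f_ge0 g_ge0.
  have E : ae_on_circ (fun x => error_density a h0 f g x =
      alpha1 ^+ 2 * f x + alpha2 ^+ 2 * g x).
    by apply: ae_imp (ae_and h0a2 Ah0a1) => x _ [e1 e2]; rewrite /error_density e1 e2.
  have iE : itg (fun x => alpha1 ^+ 2 * f x + alpha2 ^+ 2 * g x).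
    by apply: itgD; exact: itgZ.
  have mE := measurable_error_density a itf itg' mh0.
  rewrite Delta_error_density//; try exact: itg_measurable; last exact: itg_ae_eq E.
  rewrite (circint_ae mE (itg_measurable iE) E) circintD ?circintZ//; try exact: itgZ.
  by congr EFin; ring.
have Delta_ub f g : D (f, g) ->
    (Delta a h0 f g <= (alpha1 ^+ 2 * P1 + alpha2 ^+ 2 * P2)%:E)%E.
  move=> [/= fD gD]; have [[_ f_ge0 _] _] := fD; have [[_ g_ge0 _] _] := gD.
  have [itf fP] := power_class_itg fD; have [itg' gP] := power_class_itg gD.
  by rewrite DeltaE// lee_fin lerD// ler_wpM2l// sqr_ge0.
have Delta0 : Delta a h0 f0 g0 = (alpha1 ^+ 2 * P1 + alpha2 ^+ 2 * P2)%:E.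
  rewrite DeltaE//.
  set c1 := P1 - (2 * pi)^-1 * circint f0.
  set c2 := P2 - (2 * pi)^-1 * circint g0.
  suff [e1 e2] : c1 * alpha1 ^+ 2 = 0 /\ c2 * alpha2 ^+ 2 = 0.
    by congr EFin; move: e1 e2; rewrite /c1 /c2; lra.
  have c10 : 0 <= c1 by rewrite subr_ge0.
  have c20 : 0 <= c2 by rewrite subr_ge0.
  have [c12|c12] := leP (c1 + c2) 0.
    have -> : c1 = 0 by lra.
    have -> : c2 = 0 by lra.
    by rewrite !mul0r.
  (* Adding the whole slack brings the mean to exactly [P], so the raised density stays in its
     class. *)
  have power_class_shift P (f : R -> R) : power_class P f ->
      power_class P (fun x => f x + (P - (2 * pi)^-1 * circint f)).
    move=> fP; have [[_ f_ge0 _] _] := fP; have [itf fle] := power_class_itg fP.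
    have its : itg (fun x => f x + (P - (2 * pi)^-1 * circint f)).
      by apply: itgD => //; exact: itg_cst.
    split; first split.
    - exact: itg_measurable.
    - by move=> x cx; rewrite addr_ge0 ?f_ge0// subr_ge0.
    - exact: its.
    rewrite mean_EFin// lee_fin circintD//; last exact: itg_cst.
    rewrite circint_cst; set F := circint f.
    have -> // : (2 * pi)^-1 * (F + (P - (2 * pi)^-1 * F) * (2 * pi)) = P.
    have : (2 * pi : R) != 0 by rewrite -invr_eq0 gt_eqF.
    by move: (2 * pi : R) => p p0; field.
  have := slack_null (a := a) if0 ig0 f00 g00 f0g0_minimal c10 c20 c12.
  move=> /(_ (f0g0_max _ _ (power_class_shift _ _ f0_class)
                (power_class_shift _ _ g0_class))).
  (* The moduli are the constants [alpha1] and [alpha2] almost everywhere, so evaluating at a single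
     good point suffices. *)
  move=> slack; have [x _ [[s1 s2] [e1 e2]]] := ae_ex (ae_and slack (ae_and h0a2 Ah0a1)).
  by move: s1 s2; rewrite -/h0 e1 e2.
have [h0L h0_min] : optimal_char a f0 g0 h0 by exact: optimal_charP h0B.
have h0H : Hclass N D h0.
  move=> [f g] [/= fD gD]; have [[_ f_ge0 _] _] := fD; have [[_ g_ge0 _] _] := gD.
  have [itf _] := power_class_itg fD; have [itg' _] := power_class_itg gD.
  apply: (bounded_vanishing_L2N _ _ vh0 h0B); first exact: itgD.
  by move=> x cx; rewrite addr_ge0 ?f_ge0 ?g_ge0.
have D0 : D (f0, g0) by split.
have worst0 : (worst_error a D h0 <= Delta a h0 f0 g0)%E.
  by apply: ge_ereal_sup => _ [[f g] Dfg <-]; rewrite Delta0; exact: Delta_ub.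
split; first split=> //.
  exists h0; first by split.
  (* [h0] is an admissible competitor at every pair of [D], minimal or not, so its error bounds the
     minimal error there. *)
  move=> f g h Dfg [_ h_min]; rewrite Delta0.
  by apply: le_trans (Delta_ub _ _ Dfg); apply: h_min; exact: (h0H _ Dfg).
split=> //; apply/eqP; rewrite eq_le; apply/andP; split.
  by apply: ereal_inf_lbound; exists h0.
(* The worst error of any [h] is at least its error at ([f0], [g0]), hence at least the minimum
   there, which is attained by [h0] and bounds the worst error of [h0]. *)
apply: le_ereal_inf_tmp => _ [h hH <-]; apply: le_trans worst0 _.
apply: le_trans (h0_min _ (hH _ D0)) _.
by apply: ereal_sup_ubound; exists (f0, g0).
Qed.
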